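(* Let $n\ge2$ and let $M^n$ be an $n$-dimensional Riemannian submanifold of a real space form $\widetilde N^{n+p}(c)$ (a Riemannian manifold of constant sectional curvature $c$) endowed with the semi-symmetric non-metric connection $\widetilde\nabla_XY=\mathring{\widetilde\nabla}_XY+\phi(Y)X$ associated with a $1$-form $\phi$. Then for every $x\in M^n$ and every unit vector $X\in T_xM^n$, $$\operatorname{Ric}(X)\ \le\ (n-1)c-\lambda+s(X,X)-n\,\phi(H)+\widetilde g\bigl(P^\perp,\sigma(X,X)\bigr)+\frac{n^2}{4}\|H\|^2 .$$ Equality holds if and only if, for every $\alpha\in\{n+1,\dots,n+p\}$, in the orthonormal frame $\{e_1=X,e_2,\dots,e_n\}$ of $T_xM^n$, one has $\sigma^\alpha_{11}=\frac n2H^\alpha$ and $\sigma^\alpha_{1j}=0$ for all $j\ge2$.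
   Context: Setting and notation. $\mathring{\widetilde\nabla}$ is the Levi-Civita connection of the ambient metric $\widetilde g$. Curvature convention: $R(X,Y)Z=\nabla_X\nabla_YZ-\nabla_Y\nabla_XZ-\nabla_{[X,Y]}Z$, $R(X,Y,Z,W)=g(R(X,Y)Z,W)$ (so constant sectional curvature $c$ means $R(X,Y,Z,W)=c\{g(X,W)g(Y,Z)-g(X,Z)g(Y,W)\}$ for the Levi-Civita curvature). For a $1$-form $\phi$ on $\widetilde N$, the (Agashe–Chafle) semi-symmetric non-metric connection is $\widetilde\nabla_XY=\mathring{\widetilde\nabla}_XY+\phi(Y)X$. The vector field $P$ is defined by $\widetilde g(P,X)=\phi(X)$; along $M^n$ write $P=P^\top+P^\perp$ (tangential and normal parts). The $(0,2)$-tensor $s$ on $\widetilde N$ is $s(X,Y)=(\mathring{\widetilde\nabla}_X\phi)(Y)-\phi(X)\phi(Y)$. $M^n$ carries the induced metric. The induced connection $\nabla$ and second fundamental form $\sigma$ are defined by $\widetilde\nabla_XY=\nabla_XY+\sigma(X,Y)$ (tangential plus normal part) for $X,Y$ tangent to $M$; $\sigma$ coincides with the usual Levi-Civita second fundamental form. $R$ denotes the curvature tensor of the induced connection $\nabla$ on $M$. Given orthonormal frames $\{e_1,\dots,e_n\}$ of $T_xM$ and $\{e_{n+1},\dots,e_{n+p}\}$ of the normal space $T^\perp_xM$: $\sigma^\alpha_{ij}=\widetilde g(\sigma(e_i,e_j),e_\alpha)$, $H=\frac1n\sum_i\sigma(e_i,e_i)$, $H^\alpha=\frac1n\sum_i\sigma^\alpha_{ii}$,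 $\lambda=\sum_{i=1}^n s(e_i,e_i)$ (trace of $s$ over $T_xM$), and $\phi(H)=\widetilde g(P^\perp,H)$. Convention for the Ricci curvature: for a unit $X=e_1$ completed to an orthonormal basis of $T_xM$, $\operatorname{Ric}(X):=\sum_{j=2}^nR(X,e_j,e_j,X)$. *)

(* Defs.v *)
From HB Require Import structures.
From mathcomp Require Import all_boot all_order all_algebra.
From mathcomp Require Import all_classical all_reals all_analysis.
Import Order.TTheory GRing.Theory Num.Theory.
Import numFieldNormedType.Exports.

Set Implicit Arguments.
Unset Strict Implicit.
Unset Printing Implicit Defensive.

Local Open Scope classical_set_scope.
Local Open Scope ring_scope.

(* Points, and tangent vectors read in a chart, are row vectors; a bilinear
   form is a matrix G acting by v G w^T, and a covector is a column. *)

Section Smooth.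
Context {R : realType} {m : nat} {V : normedModType R}.

Fixpoint Ck_on (k : nat) (U : set 'rV[R]_m) (f : 'rV[R]_m -> V) : Prop :=
  (forall x, U x -> {for x, continuous f}) /\
  match k with
  | 0 => True
  | k'.+1 => forall v, (forall x, U x -> derivable f x v) /\
                       Ck_on k' U (fun x => 'D_v f x)
  end.

(* Only used for U open. *)
Definition smooth_on (U : set 'rV[R]_m) (f : 'rV[R]_m -> V) : Prop :=
  forall k, Ck_on k U f.

End Smooth.

Section Manifolds.
Context {R : realType}.

(* The atlas need not be maximal. [chart_inv i] only matters on the image of the
   chart, where it is the inverse of [chart_map i]. *)
Record manifold (m : nat) := Manifold {
  carrier :> topologicalType;
  chart : Type;
  chart_dom : chart -> set carrier;
  chart_map : chart -> carrier -> 'rV[R]_m;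
  chart_inv : chart -> 'rV[R]_m -> carrier;
  chart_dom_open : forall i, open (chart_dom i);
  chart_map_open : forall i, open (chart_map i @` chart_dom i);
  chart_mapK : forall i x, chart_dom i x -> chart_inv i (chart_map i x) = x;
  chart_map_continuous : forall i x, chart_dom i x -> {for x, continuous (chart_map i)};
  chart_inv_continuous : forall i u, (chart_map i @` chart_dom i) u ->
    {for u, continuous (chart_inv i)};
  transition_smooth : forall i j,
    smooth_on (chart_map i @` (chart_dom i `&` chart_dom j)) (chart_map j \o chart_inv i);
  chart_cover : forall x, exists i, chart_dom i x;
  manifold_hausdorff : hausdorff_space carrier;
  manifold_second_countable : @second_countable carrier
}.

Definition chart_codom m (N : manifold m) (k : chart N) : set 'rV[R]_m :=
  chart_map k @` chart_dom k.

Definition transition m (N : manifold m) (i j : chart N) :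
  'rV[R]_m -> 'rV[R]_m := chart_map j \o @chart_inv m N i.

Definition ip m (G : 'M[R]_m) (v w : 'rV[R]_m) : R := (v *m G *m w^T) 0 0.

Definition ev m (a : 'cV[R]_m) (v : 'rV[R]_m) : R := (v *m a) 0 0.

Record riemannian_metric m (N : manifold m) := RiemannianMetric {
  metric_coef :> chart N -> 'rV[R]_m -> 'M[R]_m;
  metric_smooth : forall k, smooth_on (chart_codom k) (metric_coef k);
  metric_sym : forall k y, chart_codom k y ->
    (metric_coef k y)^T = metric_coef k y;
  metric_pos : forall k y v, chart_codom k y -> v != 0 ->
    0 < ip (metric_coef k y) v v;
  metric_change : forall j k x v w, chart_dom j x -> chart_dom k x ->
    ip (metric_coef j (chart_map j x)) v w =
    ip (metric_coef k (chart_map k x)) ('D_v (transition j k) (chart_map j x))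
                                   ('D_w (transition j k) (chart_map j x))
}.

Record one_form m (N : manifold m) := OneForm {
  form_coef :> chart N -> 'rV[R]_m -> 'cV[R]_m;
  form_smooth : forall k, smooth_on (chart_codom k) (form_coef k);
  form_change : forall j k x v, chart_dom j x -> chart_dom k x ->
    ev (form_coef j (chart_map j x)) v =
    ev (form_coef k (chart_map k x)) ('D_v (transition j k) (chart_map j x))
}.

Section Maps.
Context {n m : nat} {M : manifold n} {N : manifold m}.

Definition local_map (f : M -> N) (i : chart M) (k : chart N) :
  'rV[R]_n -> 'rV[R]_m := chart_map k \o f \o @chart_inv n M i.

Definition local_dom (f : M -> N) (i : chart M) (k : chart N) : set 'rV[R]_n :=
  chart_map i @` (chart_dom i `&` f @^-1` chart_dom k).

Definition immersion (f : M -> N) : Prop :=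
  continuous f /\
  forall i k,
    smooth_on (local_dom f i k) (local_map f i k) /\
    forall u, local_dom f i k u ->
      forall v, 'D_v (local_map f i k) u = 0 -> v = 0.

End Maps.
End Manifolds.

(* Connections, over an open set U of R^m (the image of a chart). A vector
   field is a map 'rV_m -> 'rV_m, of which only the values on U matter. *)
Section Connections.
Context {R : realType} {m : nat}.
Implicit Types (U : set 'rV[R]_m) (G : 'rV[R]_m -> 'M[R]_m).

Definition vfield := 'rV[R]_m -> 'rV[R]_m.

Implicit Types (X Y Z W : vfield) (D : vfield -> vfield -> vfield).

Definition lie_bracket X Y : vfield :=
  fun u => 'D_(X u) Y u - 'D_(Y u) X u.

Record affine_connection U D : Prop := AffineConnection {
  connection_smooth : forall X Y, smooth_on U X -> smooth_on U Y ->
    smooth_on U (D X Y);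
  connectionDl : forall X X' Y, smooth_on U X -> smooth_on U X' ->
    smooth_on U Y -> forall u, U u ->
    D (fun z => X z + X' z) Y u = D X Y u + D X' Y u;
  connectionZl : forall (h : 'rV[R]_m -> R^o) X Y, smooth_on U h ->
    smooth_on U X -> smooth_on U Y -> forall u, U u ->
    D (fun z => h z *: X z) Y u = h u *: D X Y u;
  connectionDr : forall X Y Y', smooth_on U X -> smooth_on U Y ->
    smooth_on U Y' -> forall u, U u ->
    D X (fun z => Y z + Y' z) u = D X Y u + D X Y' u;
  connection_leibniz : forall (h : 'rV[R]_m -> R^o) X Y, smooth_on U h ->
    smooth_on U X -> smooth_on U Y -> forall u, U u ->
    D X (fun z => h z *: Y z) u = 'D_(X u) h u *: Y u + h u *: D X Y u
}.

Definition torsion_free U D : Prop :=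
  forall X Y, smooth_on U X -> smooth_on U Y -> forall u, U u ->
    D X Y u - D Y X u = lie_bracket X Y u.

Definition metric_compatible U G D : Prop :=
  forall X Y Z, smooth_on U X -> smooth_on U Y -> smooth_on U Z ->
  forall u, U u ->
    'D_(X u) (fun z => ip (G z) (Y z) (Z z) : R^o) u =
    ip (G u) (D X Y u) (Z u) + ip (G u) (Y u) (D X Z u).

Definition levi_civita U G D : Prop :=
  [/\ affine_connection U D, torsion_free U D & metric_compatible U G D].

Definition curvature D X Y Z : vfield :=
  fun u => D X (D Y Z) u - D Y (D X Z) u - D (lie_bracket X Y) Z u.

(* R(v,w)z at the point u. Curvature being tensorial, the vectors may be
   extended to any vector fields: we take the constant ones of the chart. *)
Definition curvature_at D (u v w z : 'rV[R]_m) : 'rV[R]_m :=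
  curvature D (cst v) (cst w) (cst z) u.

Definition sectional_curvature G D (u v w : 'rV[R]_m) : R :=
  ip (G u) (curvature_at D u v w w) v /
  (ip (G u) v v * ip (G u) w w - ip (G u) v w ^+ 2).

Definition semi_symmetric (phi : 'rV[R]_m -> 'cV[R]_m) D :
    vfield -> vfield -> vfield :=
  fun X Y u => D X Y u + ev (phi u) (Y u) *: X u.

Definition cov_form D (phi : 'rV[R]_m -> 'cV[R]_m) X Y (u : 'rV[R]_m) : R :=
  'D_(X u) (fun z => ev (phi z) (Y z) : R^o) u - ev (phi u) (D X Y u).

(* The (0,2)-tensor s at the point u, computed, as in [curvature_at], on the
   constant extensions of v and w. *)
Definition s_tensor D (phi : 'rV[R]_m -> 'cV[R]_m) (u v w : 'rV[R]_m) : R :=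
  cov_form D phi (cst v) (cst w) u - ev (phi u) v * ev (phi u) w.

End Connections.

Arguments vfield : clear implicits.

(* For each chart k, D ranges over the Levi-Civita connections of the chart
   domain, hence is the restriction of the Levi-Civita connection of N. *)
Definition constant_curvature {R : realType} {m : nat} {N : manifold m}
    (g : @riemannian_metric R m N) (c : R) : Prop :=
  forall (k : chart N) D, levi_civita (chart_codom k) (g k) D ->
  forall y, chart_codom k y ->
  forall v w, row_free (col_mx v w) -> sectional_curvature (g k) D y v w = c.

(* F is an immersion, read in charts; U is an open set of R^n, and G and D are
   a metric and a connection around its image. *)
Section Immersions.
Context {R : realType} {n m : nat}.
Variables (U : set 'rV[R]_n) (F : 'rV[R]_n -> 'rV[R]_m).
Variable G : 'rV[R]_m -> 'M[R]_m.

Definition push (u v : 'rV[R]_n) : 'rV[R]_m := 'D_v F u.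

Definition normal_vector (u : 'rV[R]_n) (xi : 'rV[R]_m) : Prop :=
  forall v, ip (G (F u)) (push u v) xi = 0.

Definition induced_metric (u v w : 'rV[R]_n) : R :=
  ip (G (F u)) (push u v) (push u w).

(* D_X V for a vector field V along F: the pull-back connection. The second
   term is the connection coefficient X^a V^b D_(d_a) d_b at F u. *)
Definition cov_along (D : vfield R m -> vfield R m -> vfield R m)
    (X : vfield R n) (V : 'rV[R]_n -> 'rV[R]_m) : 'rV[R]_n -> 'rV[R]_m :=
  fun u => 'D_(X u) V u + D (cst (push u (X u))) (cst (V u)) (F u).

Definition gauss_decomposition
    (D : vfield R m -> vfield R m -> vfield R m)
    (nabla : vfield R n -> vfield R n -> vfield R n)
    (sigma : vfield R n -> vfield R n -> 'rV[R]_n -> 'rV[R]_m) : Prop :=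
  forall X Y, smooth_on U X -> smooth_on U Y ->
    smooth_on U (nabla X Y) /\
    forall u, U u ->
      cov_along D X (fun z => push z (Y z)) u =
        push u (nabla X Y u) + sigma X Y u /\
      normal_vector u (sigma X Y u).

Definition tangent_frame (u : 'rV[R]_n) (e : 'I_n -> 'rV[R]_n) : Prop :=
  forall i j, induced_metric u (e i) (e j) = (i == j)%:R.

Definition normal_frame p (u : 'rV[R]_n) (nu : 'I_p -> 'rV[R]_m) : Prop :=
  (forall a, normal_vector u (nu a)) /\
  forall a b, ip (G (F u)) (nu a) (nu b) = (a == b)%:R.

(* Ric(e i0), in the orthonormal basis e. *)
Definition Ricci (nabla : vfield R n -> vfield R n -> vfield R n)
    (u : 'rV[R]_n) (e : 'I_n -> 'rV[R]_n) (i0 : 'I_n) : R :=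
  \sum_(j < n | j != i0)
    induced_metric u (curvature_at nabla u (e i0) (e j) (e j)) (e i0).

Definition mean_curvature
    (sff : 'rV[R]_n -> 'rV[R]_n -> 'rV[R]_m) (e : 'I_n -> 'rV[R]_n) :
    'rV[R]_m :=
  n%:R^-1 *: \sum_(j < n) sff (e j) (e j).

End Immersions.

(* Main.v *)
Require Import Defs.
From HB Require Import structures.
From mathcomp Require Import all_boot all_order all_algebra.
From mathcomp Require Import all_classical all_reals all_analysis.
From mathcomp Require Import ring lra.
Import Order.TTheory GRing.Theory Num.Theory.
Import numFieldNormedType.Exports.

(** The inequality is the Gauss equation followed by a completed square.

    Write dF for the differential of the immersion read in charts, II for the
    second fundamental form sigma, R0 for the Levi-Civita curvature and
    phi, s for the 1-form and the tensor of the semi-symmetric connection.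
    Decomposing the second covariant derivatives of the tangent fields dF(z)
    along the submanifold gives ([gauss_equation])
      R(v,w,z,t) = R0(v,w,z,t) + (s(v,z) + phi(II(v,z))) g(w,t)
                   - (s(w,z) + phi(II(w,z))) g(v,t)
                   + <II(v,t), II(w,z)> - <II(w,t), II(v,z)>.
    Two facts make it work.  Differentiating <dF(t), II(w,z)> = 0 trades the
    tangential part of the derivative of II for a product of two values of II
    ([weingarten]); antisymmetrizing the derivatives of dF(z) in v and w
    leaves the ambient curvature and s, because the third derivatives of F
    commute and the Christoffel symbols are symmetric
    ([ambient_derivative_antisym]).

    For v = t = e_1 and w = z = e_j in an orthonormal frame, the term R0 is the
    sectional curvature c of a tangent plane.  Summing over j >= 2 and writing
    n H for the trace of II,
      bound - Ric(e_1) = |II(e_1,e_1) - (n/2) H|^2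
                         + sum_(j >= 2) |II(e_1,e_j)|^2
    ([ricci_completed_square]).  The inequality follows, and equality means
    that these normal vectors vanish, which can be read on a normal frame since
    tangent and normal frames together form a basis ([normal_vector_eq0]).

    Everything is computed in one chart of each manifold.  The calculus this
    takes is derived from the mean value theorem along segments: derivatives
    of smooth maps are linear in the direction ([is_deriveDv]), smooth maps are
    differentiable ([smooth_scalar_differentiable]), and mixed derivatives
    commute ([derive_comm]). *)

Set Implicit Arguments.
Unset Strict Implicit.
Unset Printing Implicit Defensive.

Local Open Scope classical_set_scope.
Local Open Scope ring_scope.

(** * Derivatives along a direction *)

Section DirectionalDerivative.
Context {R : realType}.

Lemma is_derive_curve (V W : normedModType R) (f : V -> W) (x h : V) (t : R) :
  derivable f (x + t *: h) h ->
  is_derive t (1 : R) (fun s : R => f (x + s *: h)) ('D_h f (x + t *: h)).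
Proof.
move=> df.
have E : (fun s : R => s^-1 *: ((f \o shift (x + t *: h)) (s *: h) - f (x + t *: h)))
   = (fun s : R => s^-1 *: (((fun s : R => f (x + s *: h)) \o shift t) (s *: (1:R)) -
       f (x + t *: h))).
  apply/funext => s /=; congr (_ *: (f _ - _)).
  by rewrite [s%:A]mulr1 scalerDl addrCA.
apply: DeriveDef; first by move: df; rewrite /derivable E.
by rewrite /derive E.
Qed.

(** The one-variable mean value theorem on the segment from x to x + h: the
    direction is h itself, so the parameter runs over [0, 1] for every h. *)
Lemma mean_value (V : normedModType R) (f : V -> R) (x h : V) :
  (forall t : R, 0 <= t <= 1 -> derivable f (x + t *: h) h) ->
  exists2 t : R, 0 <= t <= 1 & f (x + h) - f x = 'D_h f (x + t *: h).
Proof.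
move=> df.
pose g (s : R) := f (x + s *: h).
have [|||c] := @MVT_segment R g (fun s => 'D_h f (x + s *: h)) 0 1.
- exact: ler01.
- move=> t; rewrite in_itv/= => /andP[t0 t1]; apply: is_derive_curve.
  by apply: df; rewrite !ltW.
- apply: derivable_within_continuous => t; rewrite in_itv/= => tI.
  by have /is_derive_curve [] := df _ tI.
rewrite in_itv/= => c01; rewrite /g scale1r scale0r addr0 subr0 mulr1 => E.
by exists c.
Qed.

Lemma is_deriveZv (V W : normedModType R) (f : V -> W) (x v : V) (k : R) :
  derivable f x v -> is_derive x (k *: v) f (k *: 'D_v f x).
Proof.
move=> df.
have [->|k0] := eqVneq k 0; first by rewrite !scale0r; exact: is_derive0.
suff H : h^-1 *: ((f \o shift x) (h *: (k *: v)) - f x) @[h --> 0^'] -->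
    k *: 'D_v f x.
  by apply: DeriveDef; [apply/cvg_ex; exists (k *: 'D_v f x)|exact: cvg_lim H].
have -> : (fun h : R => h^-1 *: ((f \o shift x) (h *: (k *: v)) - f x)) =
   (fun h : R => k *: ((fun h : R => h^-1 *: ((f \o shift x) (h *: v) - f x)) (h * k))).
  apply/funext => h /=; rewrite !scalerA; congr (_ *: _).
  by rewrite invfM mulrCA divff // mulr1.
apply: cvgZ; first exact: cvg_cst.
apply: (@cvg_comp _ _ _ (fun h : R => h * k)
   (fun h : R => h^-1 *: ((f \o shift x) (h *: v) - f x)) _ (0 : R)^'); last exact: df.
move=> A /= /nbhs_ballP[e e0 eA]; apply/nbhs_ballP; exists (e / `|k|) => /=.
  by rewrite divr_gt0 // normr_gt0.
move=> h /=; rewrite /ball/= !sub0r !normrN => hl h0.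
apply: eA; last by rewrite mulf_neq0.
by rewrite /ball/= sub0r normrN normrM -ltr_pdivlMr // normr_gt0.
Qed.

(** Controls all the intermediate points that the mean value theorem may return
    in a parallelogram of edges h v and h w, as h tends to 0. *)
Lemma near_parallelogram (V : normedModType R) (P : set V) (x v w : V) :
  nbhs x P ->
  \forall h \near (0 : R), forall s t : R, 0 <= s <= 1 -> 0 <= t <= 1 ->
    P (x + (h * s) *: v + (h * t) *: w).
Proof.
move=> /nbhs_ballP[e e0 eP].
have c0 : 0 < `|v| + `|w| + 1 by rewrite ltr_wpDl // addr_ge0.
have d0 : 0 < e / (`|v| + `|w| + 1) by rewrite divr_gt0.
apply/nbhs_ballP; exists (e / (`|v| + `|w| + 1)) => // h.
rewrite /ball/= sub0r normrN ltr_pdivlMr // => he s t /andP[s0 s1] /andP[t0 t1].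
apply: eP; rewrite -ball_normE /ball_/= -addrA opprD addNKr normrN.
apply: le_lt_trans he; apply: (le_trans (ler_normD _ _)).
rewrite !normrZ (ger0_norm s0) (ger0_norm t0) -!mulrA -mulrDr.
rewrite ler_wpM2l // -[leLHS]addr0 lerD // lerD //.
  by rewrite -[leRHS]mul1r ler_wpM2r.
by rewrite -[leRHS]mul1r ler_wpM2r.
Qed.

(** By the mean value theorem f (x + h v + h w) - f (x + h v) is h times the
    value of D_w f at a point close to x; continuity of D_w f at x is what makes
    directional derivatives add up. *)
Lemma is_deriveDv (V : normedModType R) (f : V -> R) (x v w : V) :
  derivable f x v -> (\forall y \near x, derivable f y w) ->
  {for x, continuous (fun y => 'D_w f y)} ->
  is_derive x (v + w) f ('D_v f x + 'D_w f x).
Proof.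
move=> dv dw cw.
suff H : h^-1 *: ((f \o shift x) (h *: (v + w)) - f x) @[h --> 0^'] -->
    'D_v f x + 'D_w f x.
  by apply: DeriveDef; [apply/cvg_ex; eexists; exact: H|exact: cvg_lim H].
have -> : (fun h : R => h^-1 *: ((f \o shift x) (h *: (v + w)) - f x)) =
   (fun h : R => h^-1 *: ((f \o shift x) (h *: v) - f x)) +
   (fun h : R => h^-1 *: (f (x + h *: v + h *: w) - f (x + h *: v))).
  apply/funext => h /=; rewrite [RHS]/GRing.add /= -scalerDr; congr (_ *: _).
  rewrite scalerDr [h *: v + x]addrC [_ + _ + x]addrC addrA.
  by rewrite [RHS]addrC addrA subrK.
apply: cvgD; first exact: dv.
apply/cvgrPdist_le => e e0.
have /cvgrPdist_le/(_ _ e0) ce := cw.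
have : nbhs x [set y | derivable f y w /\ `|'D_w f x - 'D_w f y| <= e].
  exact: filterI dw ce.
move=> /(near_parallelogram v w) nP.
near=> h.
have hn0 : h != 0 by near: h; exact: nbhs_dnbhs_neq.
have P : forall s t : R, 0 <= s <= 1 -> 0 <= t <= 1 ->
    derivable f (x + (h * s) *: v + (h * t) *: w) w /\
    `|'D_w f x - 'D_w f (x + (h * s) *: v + (h * t) *: w)| <= e.
  by near: h; exact: nbhs_dnbhs nP.
have I1 : (0 : R) <= (1 : R) <= (1 : R) by rewrite ler01 lexx.
have [|t tI ->] := @mean_value _ f (x + h *: v) (h *: w).
  move=> t tI; have [d _] := P 1 t I1 tI.
  by move: d; rewrite mulr1 mulrC -scalerA => /(is_deriveZv h)[].
have [d le] := P 1 t I1 tI; move: d le; rewrite mulr1 mulrC -scalerA => d le.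
have /@derive_val -> := is_deriveZv h d.
by rewrite scalerK.
Unshelve. all: by end_near. Qed.

Lemma is_derive_translate (V W : normedModType R) (f : V -> W) (x a v : V) :
  derivable f (x + a) v ->
  is_derive x v (fun z => f (z + a)) ('D_v f (x + a)).
Proof.
have E : (fun h : R => h^-1 *: ((f \o shift (x + a)) (h *: v) - f (x + a))) =
  (fun h : R => h^-1 *: (((fun z => f (z + a)) \o shift x) (h *: v) - f (x + a))).
  by apply/funext => h /=; rewrite addrA.
by move=> d; apply: DeriveDef; [move: d; rewrite /derivable E|rewrite /derive E].
Qed.

(** The mean value theorem twice: for z |-> f (z + h w) - f z along h v, then
    for D_v f along h w. *)
Lemma second_difference (V : normedModType R) (f : V -> R) (x v w : V) (h : R) :
  (forall s t : R, 0 <= s <= 1 -> 0 <= t <= 1 ->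
     let y := x + (h * s) *: v + (h * t) *: w in
     derivable f y v /\ derivable ('D_v f) y w) ->
  exists s t : R, [/\ 0 <= s <= 1, 0 <= t <= 1 &
   f (x + h *: v + h *: w) - f (x + h *: v) - (f (x + h *: w) - f x) =
   h ^+ 2 * 'D_w ('D_v f) (x + (h * s) *: v + (h * t) *: w)].
Proof.
move=> P.
have I1 : (0 : R) <= (1 : R) <= (1 : R) by rewrite ler01 lexx.
have I0 : (0 : R) <= (0 : R) <= (1 : R) by rewrite ler01 lexx.
pose phi z := f (z + h *: w) - f z.
have dphi s : 0 <= s <= 1 -> is_derive (x + s *: (h *: v)) (h *: v) phi
    (h *: ('D_v f (x + (h * s) *: v + h *: w) - 'D_v f (x + (h * s) *: v))).
  move=> sI; have [d1 _] := P s 1 sI I1; have [d0 _] := P s 0 sI I0.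
  move: d1 d0; rewrite mulr1 mulr0 scale0r addr0 => d1 d0.
  rewrite scalerA [s * h]mulrC scalerBr.
  apply: is_deriveB; last exact: is_deriveZv.
  have [d1' <-] := is_deriveZv h d1.
  exact: is_derive_translate.
have [|s sI] := @mean_value _ phi x (h *: v); first by move=> s /dphi[].
have /@derive_val -> := dphi s sI.
have [|t tI] := @mean_value _ ('D_v f) (x + (h * s) *: v) (h *: w).
  move=> t tI; have [_ d] := P s t sI tI.
  by rewrite [t *: _]scalerA [t * h]mulrC; have [] := is_deriveZv h d.
rewrite [t *: _]scalerA [t * h]mulrC.
have [_ d] := P s t sI tI; have /@derive_val -> := is_deriveZv h d.
move=> -> E; exists s, t; split=> //.
by rewrite -[RHS]/(h ^+ 2 *: _) expr2 -scalerA -E /phi.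
Qed.

(** Schwarz: the second difference of f is symmetric in v and w, so for every
    small h the two mixed derivatives agree at points of the same small
    parallelogram. *)
Lemma derive_comm (V : normedModType R) (f : V -> R) (x v w : V) :
  (\forall y \near x, derivable f y v /\ derivable ('D_v f) y w) ->
  (\forall y \near x, derivable f y w /\ derivable ('D_w f) y v) ->
  {for x, continuous ('D_w ('D_v f))} -> {for x, continuous ('D_v ('D_w f))} ->
  'D_w ('D_v f) x = 'D_v ('D_w f) x.
Proof.
move=> dvw dwv cvw cwv.
apply/eqP; rewrite -subr_eq0 -normr_le0; apply/ler_addgt0Pr => e e0.
rewrite add0r.
have e20 : 0 < e / 2 by rewrite divr_gt0.
have /cvgrPdist_le/(_ _ e20) ce1 := cvw.
have /cvgrPdist_le/(_ _ e20) ce2 := cwv.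
have n1 := near_parallelogram v w (filterI dvw ce1).
have n2 := near_parallelogram w v (filterI dwv ce2).
have n3 : \forall h \near (0:R)^', h != 0 :> R by exact: nbhs_dnbhs_neq.
have [h [[P1 P2] h0]] := filter_ex (filterI (filterI (nbhs_dnbhs (n1 _)) (nbhs_dnbhs (n2 _))) n3).
have [|s [t [sI tI E]]] := @second_difference _ f x v w h.
  by move=> s t sI tI; have [] := P1 s t sI tI.
have [|s' [t' [sI' tI' E']]] := @second_difference _ f x w v h.
  by move=> s' t' sI' tI'; have [] := P2 s' t' sI' tI'.
have [_ /= le1] := P1 s t sI tI.
have [_ /= le2] := P2 s' t' sI' tI'.
have EE : 'D_w ('D_v f) (x + (h * s) *: v + (h * t) *: w) =
          'D_v ('D_w f) (x + (h * s') *: w + (h * t') *: v).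
  apply: (@mulfI _ (h ^+ 2)); first by rewrite expf_neq0.
  by rewrite -E -E' [x + h *: w + _]addrAC; ring.
rewrite -EE in le2.
rewrite (splitr e); apply: le_trans (lerD le1 le2).
by rewrite [X in _ <= _ + X]distrC; apply: le_trans (ler_normD _ _); rewrite subrKA.
Qed.

End DirectionalDerivative.

(** * Smooth maps on open sets of a coordinate space *)

Section SmoothMaps.
Context {R : realType} {m : nat}.
Implicit Types (U : set 'rV[R]_m) (x v w : 'rV[R]_m).

Lemma smooth_continuous (V : normedModType R) U (f : 'rV[R]_m -> V) x :
  smooth_on U f -> U x -> {for x, continuous f}.
Proof. by move=> /(_ 0%N)[cf _] /cf. Qed.

Lemma smooth_derivable (V : normedModType R) U (f : 'rV[R]_m -> V) x v :
  smooth_on U f -> U x -> derivable f x v.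
Proof. by move=> /(_ 1%N)[_ /(_ v)[df _]] /df. Qed.

Lemma smooth_derive (V : normedModType R) U (f : 'rV[R]_m -> V) v :
  smooth_on U f -> smooth_on U ('D_v f).
Proof. by move=> sf k; have [_ /(_ v)[]] := sf k.+1. Qed.

Lemma open_near (T : topologicalType) (U : set T) (x : T) :
  open U -> U x -> \forall y \near x, U y.
Proof. by move=> oU Ux; apply: open_nbhs_nbhs. Qed.

Lemma near_eq_continuous (T S : topologicalType) (f g : T -> S) (x : T) :
  (\forall y \near x, f y = g y) -> {for x, continuous f} ->
  {for x, continuous g}.
Proof.
move=> fg cf; rewrite /prop_for /continuous_at -(nbhs_singleton fg).
apply: cvg_trans cf; apply: near_eq_cvg.
by apply: filterS fg => y.
Qed.

Lemma Ck_on_eq (V : normedModType R) U k (f g : 'rV[R]_m -> V) :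
  open U -> (forall x, U x -> f x = g x) -> Ck_on k U f -> Ck_on k U g.
Proof.
move=> oU; elim: k f g => [|k IH] f g fg [cf df].
all: have nfg x : U x -> \forall y \near x, f y = g y
       by move=> Ux; apply: filterS (open_near oU Ux).
all: split; first by move=> x Ux; apply: (near_eq_continuous (nfg x Ux)); apply: cf.
  by [].
move=> v; have [dv Dv] := df v; split.
  by move=> x Ux; apply: near_eq_derivable (dv x Ux); apply: nfg.
by apply: IH Dv => x Ux; apply: near_eq_derive; apply: nfg.
Qed.

Lemma is_derive_linear (V W X : normedModType R) (L : {linear W -> X})
    (f : V -> W) (x v : V) : continuous L -> derivable f x v ->
  is_derive x v (L \o f) (L ('D_v f x)).
Proof.
move=> cL df.
suff H : h^-1 *: (((L \o f) \o shift x) (h *: v) - (L \o f) x) @[h --> 0^'] -->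
    L ('D_v f x).
  by apply: DeriveDef; [apply/cvg_ex; eexists; exact: H|exact: cvg_lim H].
have -> : (fun h : R => h^-1 *: (((L \o f) \o shift x) (h *: v) - (L \o f) x)) =
    L \o (fun h : R => h^-1 *: ((f \o shift x) (h *: v) - f x)).
  by apply/funext => h /=; rewrite (linearZZ L) (linearB L).
apply: cvg_comp; first exact: df.
exact: cL.
Qed.

(** Used for coordinates and for multiples of a fixed vector. *)
Lemma Ck_on_linear (V W : normedModType R) (L : {linear V -> W}) U k
    (f : 'rV[R]_m -> V) : open U -> continuous L ->
  Ck_on k U f -> Ck_on k U (L \o f).
Proof.
move=> oU cL; elim: k f => [|k IH] f [cf df].
all: split; first by move=> x Ux; apply: continuous_comp; [exact: cf|exact: cL].
  by [].
move=> v; have [dv Dv] := df v; split=> [x Ux|].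
  by have [] := is_derive_linear cL (dv x Ux).
apply: Ck_on_eq (IH _ Dv) => // x Ux /=.
by have [_ ->] := is_derive_linear cL (dv x Ux).
Qed.

Lemma smooth_linear (V W : normedModType R) (L : {linear V -> W}) U
    (f : 'rV[R]_m -> V) : open U -> continuous L ->
  smooth_on U f -> smooth_on U (L \o f).
Proof. by move=> oU cL sf k; apply: Ck_on_linear. Qed.

Lemma Ck_on_add (V : normedModType R) U k (f g : 'rV[R]_m -> V) : open U ->
  Ck_on k U f -> Ck_on k U g -> Ck_on k U (fun x => f x + g x).
Proof.
move=> oU; elim: k f g => [|k IH] f g [cf df] [cg dg].
all: split; first by move=> x Ux; exact: cvgD (cf x Ux) (cg x Ux).
  by [].
move=> v; have [dfv Dfv] := df v; have [dgv Dgv] := dg v; split=> [x Ux|].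
  by apply: derivableD; [exact: dfv|exact: dgv].
apply: Ck_on_eq (IH _ _ Dfv Dgv) => // x Ux /=.
by rewrite -deriveD; [|exact: dfv|exact: dgv].
Qed.

Lemma smooth_add (V : normedModType R) U (f g : 'rV[R]_m -> V) : open U ->
  smooth_on U f -> smooth_on U g -> smooth_on U (fun x => f x + g x).
Proof. by move=> oU sf sg k; apply: Ck_on_add. Qed.

Lemma smooth_cst (V : normedModType R) U (a : V) :
  smooth_on U (cst a : 'rV[R]_m -> V).
Proof.
move=> k; elim: k a => [|k IH] a.
all: split; first by move=> x _; exact: cst_continuous.
  by [].
move=> v; split=> [x _|]; first exact: derivable_cst.
rewrite (_ : (fun x => _) = cst 0); first exact: IH.
by apply/funext => x; rewrite derive_cst.
Qed.

Lemma smooth_coord p q U (f : 'rV[R]_m -> 'M[R]_(p, q)) i j : open U ->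
  smooth_on U f -> smooth_on U (fun x => f x i j : R^o).
Proof.
move=> oU sf.
pose L (N : 'M[R]_(p, q)) : R^o := N i j.
have linL : linear L by move=> a A B; rewrite /L !mxE.
pose LM := GRing.isLinear.Build _ _ _ _ _ linL.
pose LL : {linear 'M[R]_(p, q) -> R^o} := HB.pack L LM.
rewrite -[X in smooth_on _ X]/(LL \o f).
by apply: smooth_linear => // N; exact: coord_continuous.
Qed.

Lemma smooth_scalel (V : normedModType R) U (h : 'rV[R]_m -> R^o) (a : V) :
  open U -> smooth_on U h -> smooth_on U (fun x => h x *: a).
Proof.
move=> oU sh.
pose L (k : R^o) : V := k *: a.
have linL : linear L by move=> k b c; rewrite /L scalerDl scalerA.
pose LM := GRing.isLinear.Build _ _ _ _ _ linL.
pose LL : {linear R^o -> V} := HB.pack L LM.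
rewrite -[X in smooth_on _ X]/(LL \o h).
by apply: smooth_linear => // N; exact: scalel_continuous.
Qed.

End SmoothMaps.

Arguments smooth_cst {R m V U} a.

(** * Differentiability, chain rule and symmetry of second derivatives *)

Section ScalarCalculus.
Context {R : realType} {m : nat}.
Implicit Types (U : set 'rV[R]_m) (x v w : 'rV[R]_m) (f : 'rV[R]_m -> R^o).

Lemma smooth_scalar_deriveD U f x v w : open U -> smooth_on U f -> U x ->
  'D_(v + w) f x = 'D_v f x + 'D_w f x.
Proof.
move=> oU sf Ux; apply: (@derive_val _ _ _ _ _ _ _ (is_deriveDv _ _ _)).
- exact: smooth_derivable sf Ux.
- by apply: filterS (open_near oU Ux) => y; exact: smooth_derivable.
- exact: smooth_continuous (smooth_derive w sf) Ux.
Qed.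

Lemma smooth_scalar_derive_sum U f x v : open U -> smooth_on U f -> U x ->
  'D_v f x = \sum_(a < m) v 0 a * 'D_(delta_mx 0 a) f x.
Proof.
move=> oU sf Ux; rewrite {1}[v]row_sum_delta.
elim/big_ind2 : _ => [|v1 d1 v2 d2 E1 E2|a _]; first exact: derive0.
  by rewrite (smooth_scalar_deriveD _ _ oU sf Ux) E1 E2.
by have [_ ->] := is_deriveZv (v 0 a) (smooth_derivable (v := delta_mx 0 a) sf Ux).
Qed.

Lemma smooth_scalar_derive_comm U f x v w : open U -> smooth_on U f -> U x ->
  'D_w ('D_v f) x = 'D_v ('D_w f) x.
Proof.
move=> oU sf Ux; apply: derive_comm.
- apply: filterS (open_near oU Ux) => y Uy.
  by split; [exact: smooth_derivable sf Uy|exact: smooth_derivable (smooth_derive v sf) Uy].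
- apply: filterS (open_near oU Ux) => y Uy.
  by split; [exact: smooth_derivable sf Uy|exact: smooth_derivable (smooth_derive w sf) Uy].
- exact: smooth_continuous (smooth_derive w (smooth_derive v sf)) Ux.
- exact: smooth_continuous (smooth_derive v (smooth_derive w sf)) Ux.
Qed.

Lemma normr_coord_le (v : 'rV[R]_m) (a : 'I_m) : `|v 0 a| <= `|v|.
Proof.
rewrite [leRHS]/Num.Def.normr/= mx_normrE.
exact: (le_bigmax _ (fun i : 'I_1 * 'I_m => `|v i.1 i.2|) (0, a)).
Qed.

(** Since D_h f is linear in h, the mean value theorem bounds
    f (x + h) - f x - D_h f x by the sum of the |h_a| times the oscillations of
    the partial derivatives D_a f on the segment. *)
Lemma smooth_scalar_differentiable U f x : open U -> smooth_on U f -> U x ->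
  differentiable f x.
Proof.
move=> oU sf Ux.
pose df v : R^o := 'D_v f x.
have lindf : linear df.
  move=> k v w; rewrite /df (smooth_scalar_deriveD _ _ oU sf Ux); congr (_ + _).
  by have [_ ->] := is_deriveZv k (smooth_derivable (v := v) sf Ux).
pose dfM := GRing.isLinear.Build _ _ _ _ _ lindf.
pose dfL : {linear 'rV[R]_m -> R^o} := HB.pack df dfM.
have cdf : continuous dfL.
  have -> : (dfL : 'rV[R]_m -> R^o) =
      (fun v => \sum_(a < m) v 0 a * 'D_(delta_mx 0 a) f x).
    by apply/funext => w; exact: smooth_scalar_derive_sum oU sf Ux.
  apply: (@continuous_big _ _ _ _ xpredT) => [|a _ w]; first exact: add_continuous.
  have ca : (w' : 'rV[R]_m) 0 a @[w' --> w] --> w 0 a by exact: coord_continuous.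
  exact: (cvgM ca (cvg_cst _)).
have E : f \o shift x = cst (f x) + dfL +o_ (0 : 'rV[R]_m) id.
  apply/eqaddoP => _/posnumP[e].
  (* m + 1 and not m, which may be 0. *)
  have m0 : 0 < (m.+1)%:R :> R by rewrite ltr0n.
  have e0 : 0 < e%:num / m.+1%:R by rewrite divr_gt0.
  have nD : \forall y \near x, forall a : 'I_m,
      `|'D_(delta_mx 0 a) f x - 'D_(delta_mx 0 a) f y| <= e%:num / m.+1%:R.
    have H a : \forall y \near x,
      `|'D_(delta_mx 0 a) f x - 'D_(delta_mx 0 a) f y| <= e%:num / m.+1%:R; last first.
      by apply: (@filter_forall _ _ _ (nbhs x) _ H).
    have /cvgrPdist_le/(_ _ e0) := smooth_continuous (smooth_derive (delta_mx 0 a) sf) Ux.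
    by [].
  have : nbhs x [set y | U y /\ forall a : 'I_m,
      `|'D_(delta_mx 0 a) f x - 'D_(delta_mx 0 a) f y| <= e%:num / m.+1%:R].
    exact: filterI (open_near oU Ux) nD.
  move=> /nbhs_ballP[r r0 rP].
  apply/nbhs_ballP; exists r => // h; rewrite -ball_normE /ball_/= sub0r normrN => hr.
  have seg t : 0 <= t <= 1 -> ball x r (x + t *: h).
    move=> /andP[t0 t1]; rewrite -ball_normE /ball_/= opprD addNKr normrN normrZ.
    by rewrite ger0_norm //; apply: le_lt_trans hr; rewrite ler_piMl.
  have [|t tI E] := @mean_value _ _ f x h.
    by move=> t /seg /rP[Ut _]; exact: smooth_derivable sf Ut.
  have [Ut nDt] := rP _ (seg t tI).
  rewrite -![(_ + _ : _ -> _) _]/(_ + _) -![(- _ : _ -> _) _]/(- _) /=.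
  rewrite opprD addrA [h + x]addrC E /df.
  rewrite (smooth_scalar_derive_sum h oU sf Ut) (smooth_scalar_derive_sum h oU sf Ux).
  rewrite -sumrB; apply: (le_trans (ler_norm_sum _ _ _)).
  apply: (@le_trans _ _ (\sum_(a < m) `|h| * (e%:num / m.+1%:R))).
    apply: ler_sum => a _; rewrite -mulrBr normrM ler_pM ?normr_coord_le //.
    by rewrite distrC nDt.
  rewrite sumr_const card_ord -mulrnAr [leRHS]mulrC ler_wpM2l //.
  by rewrite -mulr_natr mulrAC -mulrA ler_piMr // ler_pdivrMr // mul1r ler_nat.
have dE := diff_unique cdf E.
by apply/diff_locallyP; rewrite dE.
Qed.

(** F is only derivable along v, but then the curve t |-> F (t v + x) is
    differentiable and the chain rule for differentials applies to it. *)
Lemma is_derive_smooth_scalar_comp (V : normedModType R) U f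
    (F : V -> 'rV[R]_m) (x v : V) (w : 'rV[R]_m) :
  open U -> smooth_on U f -> U (F x) -> is_derive x v F w ->
  is_derive x v (f \o F) ('D_w f (F x)).
Proof.
move=> oU sf UF [dF wE].
have df := smooth_scalar_differentiable oU sf UF.
have dc : differentiable (fun t : R => F (t *: v + x)) 0.
  by apply/derivable1_diffP; move/derivable1P: dF; exact.
have dfc : differentiable (f \o (fun t : R => F (t *: v + x))) 0.
  by apply: differentiable_comp; rewrite // scale0r add0r.
have E (X : normedModType R) (k : V -> X) :
    'D_v k x = 'D_1 (fun t : R => k (t *: v + x)) 0.
  have e : (fun h : R => h^-1 *: ((k \o shift x) (h *: v) - k x)) =
    (fun h : R => h^-1 *: (((fun t : R => k (t *: v + x)) \o shift 0)
       (h *: (1 : R)) - k ((0 : R) *: v + x))).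
    by apply/funext => h /=; rewrite addr0 scale0r add0r [_%:A]mulr1.
  by rewrite /derive e.
apply: DeriveDef.
  by apply/derivable1P/derivable1_diffP.
rewrite E (deriveE _ dfc) diff_comp //; last by rewrite scale0r add0r.
by rewrite /= scale0r add0r -(deriveE _ dc) -E wE (deriveE _ df).
Qed.

End ScalarCalculus.

Section MatrixCalculus.
Context {R : realType}.

Lemma is_derive_mxP (V : normedModType R) p q (f : V -> 'M[R]_(p, q)) x v df :
  is_derive x v f df <->
  forall i j, is_derive x v (fun z => f z i j : R^o) (df i j).
Proof.
split=> [[dfx <-] i j|H].
  apply: DeriveDef; first by have /derivable_mxP := dfx; apply.
  by rewrite derive_mx // mxE.
have dfx : derivable f x v by apply/derivable_mxP => i j; have [] := H i j.
apply: DeriveDef => //; rewrite derive_mx //; apply/matrixP => i j.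
by rewrite mxE; have [_ ->] := H i j.
Qed.

Lemma derive_coord (V : normedModType R) p q (f : V -> 'M[R]_(p, q)) x v i j :
  derivable f x v -> 'D_v (fun z => f z i j : R^o) x = ('D_v f x) i j.
Proof. by move=> df; rewrite derive_mx // mxE. Qed.

Context {m : nat}.
Implicit Types (U : set 'rV[R]_m) (x v w : 'rV[R]_m).

Lemma smooth_derive_sum U p q (f : 'rV[R]_m -> 'M[R]_(p, q)) x v :
  open U -> smooth_on U f -> U x ->
  'D_v f x = \sum_(a < m) v 0 a *: 'D_(delta_mx 0 a) f x.
Proof.
move=> oU sf Ux; apply/matrixP => i j; rewrite summxE.
rewrite -derive_coord; last exact: smooth_derivable sf Ux.
rewrite (smooth_scalar_derive_sum v oU (smooth_coord i j oU sf) Ux).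
apply: eq_bigr => a _; rewrite mxE derive_coord //.
exact: smooth_derivable sf Ux.
Qed.

Lemma smooth_deriveDv U p q (f : 'rV[R]_m -> 'M[R]_(p, q)) x v w :
  open U -> smooth_on U f -> U x -> 'D_(v + w) f x = 'D_v f x + 'D_w f x.
Proof.
move=> oU sf Ux; rewrite !(smooth_derive_sum _ oU sf Ux) -big_split /=.
by apply: eq_bigr => a _; rewrite mxE scalerDl.
Qed.

Lemma smooth_deriveZv U p q (f : 'rV[R]_m -> 'M[R]_(p, q)) x v (k : R) :
  open U -> smooth_on U f -> U x -> 'D_(k *: v) f x = k *: 'D_v f x.
Proof.
move=> oU sf Ux; rewrite !(smooth_derive_sum _ oU sf Ux) scaler_sumr.
by apply: eq_bigr => a _; rewrite mxE scalerA.
Qed.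

Lemma smooth_derive_comm U p q (f : 'rV[R]_m -> 'M[R]_(p, q)) x v w :
  open U -> smooth_on U f -> U x -> 'D_w ('D_v f) x = 'D_v ('D_w f) x.
Proof.
move=> oU sf Ux; apply/matrixP => i j.
have E v1 w1 : ('D_w1 ('D_v1 f) x) i j =
    'D_w1 ('D_v1 (fun z => f z i j : R^o)) x.
  rewrite -derive_coord; last exact: smooth_derivable (smooth_derive _ sf) Ux.
  apply: near_eq_derive; apply: filterS (open_near oU Ux) => y Uy.
  by rewrite -derive_coord //; exact: smooth_derivable sf Uy.
have H := smooth_scalar_derive_comm v w oU (smooth_coord i j oU sf) Ux.
have H1 := etrans (E v w) H.
have H2 := etrans H1 (esym (E w v)).
exact: H2.
Qed.

Lemma is_derive_smooth_comp (V : normedModType R) U p q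
    (f : 'rV[R]_m -> 'M[R]_(p, q)) (F : V -> 'rV[R]_m) (x v : V) w :
  open U -> smooth_on U f -> U (F x) -> is_derive x v F w ->
  is_derive x v (f \o F) ('D_w f (F x)).
Proof.
move=> oU sf UF dF; apply/is_derive_mxP => i j.
rewrite -derive_coord; last exact: smooth_derivable sf UF.
exact: is_derive_smooth_scalar_comp oU (smooth_coord i j oU sf) UF dF.
Qed.

Lemma is_derive_mulmx (V : normedModType R) p q r (A : V -> 'M[R]_(p, q))
    (B : V -> 'M[R]_(q, r)) (x v : V) dA dB :
  is_derive x v A dA -> is_derive x v B dB ->
  is_derive x v (fun z => A z *m B z) (dA *m B x + A x *m dB).
Proof.
move=> /is_derive_mxP hA /is_derive_mxP hB; apply/is_derive_mxP => i j.
have -> : (fun z => (A z *m B z) i j : R^o) =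
    \sum_(a < q) ((fun z => A z i a) * (fun z => B z a j)).
  by apply/funext => z; rewrite mxE fct_sumE.
rewrite !mxE -big_split /=; apply: is_derive_sum => a.
apply: is_derive_eq.
by rewrite addrC /GRing.scale /= [B x a j * _]mulrC.
Qed.

Lemma is_derive_trmx (V : normedModType R) p q (A : V -> 'M[R]_(p, q))
    (x v : V) dA :
  is_derive x v A dA -> is_derive x v (fun z => (A z)^T) dA^T.
Proof.
move=> /is_derive_mxP hA; apply/is_derive_mxP => i j.
have -> : (fun z => (A z)^T i j : R^o) = (fun z => A z j i).
  by apply/funext => z; rewrite mxE.
by rewrite mxE.
Qed.

Lemma is_derive_scale (V : normedModType R) p q (h : V -> R^o)
    (A : V -> 'M[R]_(p, q)) (x v : V) (dh : R) dA :
  is_derive x v h dh -> is_derive x v A dA ->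
  is_derive x v (fun z => h z *: A z) (dh *: A x + h x *: dA).
Proof.
move=> hh /is_derive_mxP hA; apply/is_derive_mxP => i j.
have -> : (fun z => (h z *: A z) i j : R^o) = h * (fun z => A z i j).
  by apply/funext => z; rewrite mxE.
apply: is_derive_eq.
by rewrite !mxE addrC /GRing.scale /= [A x i j * _]mulrC.
Qed.

Lemma is_derive_ip (V : normedModType R) p (G : V -> 'M[R]_p)
    (X Y : V -> 'rV[R]_p) (x v : V) dG dX dY :
  is_derive x v G dG -> is_derive x v X dX -> is_derive x v Y dY ->
  is_derive x v (fun z => ip (G z) (X z) (Y z) : R^o)
    (ip dG (X x) (Y x) + ip (G x) dX (Y x) + ip (G x) (X x) dY).
Proof.
move=> hG hX hY.
have /is_derive_mxP/(_ 0 0) h :=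
  is_derive_mulmx (is_derive_mulmx hX hG) (is_derive_trmx hY).
apply: (is_derive_eq h).
by rewrite /ip mulmxDl !mxE; ring.
Qed.

Lemma is_derive_ev (V : normedModType R) p (phi : V -> 'cV[R]_p)
    (X : V -> 'rV[R]_p) (x v : V) dphi dX :
  is_derive x v phi dphi -> is_derive x v X dX ->
  is_derive x v (fun z => ev (phi z) (X z) : R^o)
    (ev dphi (X x) + ev (phi x) dX).
Proof.
move=> hp hX; have /is_derive_mxP/(_ 0 0) h := is_derive_mulmx hX hp.
apply: (is_derive_eq h).
by rewrite /ev !mxE; ring.
Qed.

End MatrixCalculus.

(** * Bilinear forms *)

Section BilinearForms.
Context {R : realType} {m : nat}.
Implicit Types (G : 'M[R]_m) (a b c : 'rV[R]_m) (k : R) (phi : 'cV[R]_m).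

Lemma ipDl G a b c : ip G (a + b) c = ip G a c + ip G b c.
Proof. by rewrite /ip !mulmxDl mxE. Qed.

Lemma ipDr G a b c : ip G c (a + b) = ip G c a + ip G c b.
Proof. by rewrite /ip linearD mulmxDr mxE. Qed.

Lemma ipZl G k a b : ip G (k *: a) b = k * ip G a b.
Proof. by rewrite /ip -!scalemxAl mxE. Qed.

Lemma ipZr G k a b : ip G a (k *: b) = k * ip G a b.
Proof. by rewrite /ip linearZ -scalemxAr mxE. Qed.

Lemma ipNl G a b : ip G (- a) b = - ip G a b.
Proof. by rewrite -scaleN1r ipZl mulN1r. Qed.

Lemma ipNr G a b : ip G a (- b) = - ip G a b.
Proof. by rewrite -scaleN1r ipZr mulN1r. Qed.

Lemma ip0l G a : ip G 0 a = 0.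
Proof. by rewrite -(scale0r a) ipZl mul0r. Qed.

Lemma ip0r G a : ip G a 0 = 0.
Proof. by rewrite -(scale0r a) ipZr mul0r. Qed.

Lemma ip_suml G (I : Type) (r : seq I) (P : pred I) (f : I -> 'rV[R]_m) a :
  ip G (\sum_(i <- r | P i) f i) a = \sum_(i <- r | P i) ip G (f i) a.
Proof.
by elim/big_rec2 : _ => [|i x y _ <-]; rewrite (ip0l, ipDl).
Qed.

Lemma ip_sumr G (I : Type) (r : seq I) (P : pred I) (f : I -> 'rV[R]_m) a :
  ip G a (\sum_(i <- r | P i) f i) = \sum_(i <- r | P i) ip G a (f i).
Proof.
by elim/big_rec2 : _ => [|i x y _ <-]; rewrite (ip0r, ipDr).
Qed.

Lemma ip_sym G a b : G^T = G -> ip G a b = ip G b a.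
Proof.
move=> sG; rewrite /ip.
have -> : b *m G *m a^T = (a *m G *m b^T)^T.
  by rewrite !trmx_mul trmxK sG mulmxA.
by rewrite [RHS]mxE.
Qed.

Lemma ip_delta G i j : ip G (delta_mx 0 i) (delta_mx 0 j) = G i j.
Proof. by rewrite /ip -rowE trmx_delta -colE !mxE. Qed.

Lemma evD phi a b : ev phi (a + b) = ev phi a + ev phi b.
Proof. by rewrite /ev mulmxDl mxE. Qed.

Lemma evZ phi k a : ev phi (k *: a) = k * ev phi a.
Proof. by rewrite /ev -scalemxAl mxE. Qed.

Lemma ipEsum G a b :
  ip G a b = \sum_i \sum_j a 0 i * b 0 j * G i j.
Proof.
rewrite [in LHS](row_sum_delta a) ip_suml; apply: eq_bigr => i _.
rewrite [in LHS](row_sum_delta b) ip_sumr; apply: eq_bigr => j _.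
by rewrite ipZl ipZr ip_delta mulrA.
Qed.

End BilinearForms.

(** * Christoffel symbols *)

(** In coordinates, a^i b^j Gamma_ij^k at y. *)
Definition christoffel {R : realType} {m : nat}
    (D : vfield R m -> vfield R m -> vfield R m) (a b y : 'rV[R]_m) : 'rV[R]_m :=
  D (cst a) (cst b) y.

Section Christoffel.
Context {R : realType} {m : nat}.
Variables (W : set 'rV[R]_m) (D : vfield R m -> vfield R m -> vfield R m).
Hypotheses (oW : open W) (aD : affine_connection W D).
Implicit Types (a b c y : 'rV[R]_m) (k : R).
Local Notation Gam := (christoffel D).

Lemma christoffelDl a b c y : W y -> Gam (a + b) c y = Gam a c y + Gam b c y.
Proof.
move=> Wy.
exact: (connectionDl aD (smooth_cst a) (smooth_cst b) (smooth_cst c) Wy).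
Qed.

Lemma christoffelZl k a b y : W y -> Gam (k *: a) b y = k *: Gam a b y.
Proof.
move=> Wy.
exact: (connectionZl aD (smooth_cst (k : R^o)) (smooth_cst a) (smooth_cst b) Wy).
Qed.

Lemma christoffelDr a b c y : W y -> Gam c (a + b) y = Gam c a y + Gam c b y.
Proof.
move=> Wy.
exact: (connectionDr aD (smooth_cst c) (smooth_cst a) (smooth_cst b) Wy).
Qed.

Lemma christoffelZr k a b y : W y -> Gam a (k *: b) y = k *: Gam a b y.
Proof.
move=> Wy.
have := connection_leibniz aD (smooth_cst (k : R^o)) (smooth_cst a) (smooth_cst b) Wy.
by rewrite derive_cst scale0r add0r.
Qed.

Lemma christoffel0l a y : W y -> Gam 0 a y = 0.
Proof. by move=> /(christoffelZl 0 0 a); rewrite !scale0r. Qed.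

Lemma christoffel0r a y : W y -> Gam a 0 y = 0.
Proof. by move=> /(christoffelZr 0 a 0); rewrite !scale0r. Qed.

Lemma christoffel_smooth a b : smooth_on W (Gam a b).
Proof. exact: (connection_smooth aD (smooth_cst a) (smooth_cst b)). Qed.

Lemma christoffel_sumr (I : Type) (r : seq I) (P : pred I)
    (f : I -> 'rV[R]_m) a y : W y ->
  Gam a (\sum_(i <- r | P i) f i) y = \sum_(i <- r | P i) Gam a (f i) y.
Proof.
move=> Wy; elim/big_rec2 : _ => [|i x z _ <-]; first exact: christoffel0r.
exact: christoffelDr.
Qed.

Lemma christoffel_suml (I : Type) (r : seq I) (P : pred I)
    (f : I -> 'rV[R]_m) a y : W y ->
  Gam (\sum_(i <- r | P i) f i) a y = \sum_(i <- r | P i) Gam (f i) a y.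
Proof.
move=> Wy; elim/big_rec2 : _ => [|i x z _ <-]; first exact: christoffel0l.
exact: christoffelDl.
Qed.

(** Expand Y in the constant frame of the chart and apply the Leibniz rule:
    a connection is the flat derivative plus its Christoffel symbols. *)
Lemma connection_cstE a Y y : smooth_on W Y -> W y ->
  D (cst a) Y y = 'D_a Y y + Gam a (Y y) y.
Proof.
move=> sY Wy.
have sYa i : smooth_on W (fun z => Y z 0 i : R^o) by exact: smooth_coord.
have sYe i : smooth_on W (fun z => Y z 0 i *: (delta_mx 0 i : 'rV[R]_m)).
  exact: smooth_scalel.
have H (r : seq 'I_m) :
    smooth_on W (fun z => \sum_(i <- r) Y z 0 i *: (delta_mx 0 i : 'rV[R]_m)) /\
    D (cst a) (fun z => \sum_(i <- r) Y z 0 i *: (delta_mx 0 i : 'rV[R]_m)) y =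
    \sum_(i <- r) (('D_a Y y) 0 i *: (delta_mx 0 i : 'rV[R]_m) +
                   Y y 0 i *: Gam a (delta_mx 0 i) y).
  elim: r => [|i r [IHs IH]].
    rewrite big_nil.
    have -> : (fun z => \sum_(i <- [::]) Y z 0 i *: (delta_mx 0 i : 'rV[R]_m)) = cst 0.
      by apply/funext => z; rewrite big_nil.
    by split; [exact: smooth_cst|exact: christoffel0r].
  have E : (fun z => \sum_(i <- i :: r) Y z 0 i *: (delta_mx 0 i : 'rV[R]_m)) =
    (fun z => Y z 0 i *: (delta_mx 0 i : 'rV[R]_m) +
              \sum_(i <- r) Y z 0 i *: (delta_mx 0 i : 'rV[R]_m)).
    by apply/funext => z; rewrite big_cons.
  split; first by rewrite E; exact: smooth_add.
  rewrite E big_cons -IH (connectionDr aD) //; last exact: smooth_cst.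
  congr (_ + _).
  have := connection_leibniz aD (sYa i) (smooth_cst a) (smooth_cst (delta_mx 0 i)) Wy.
  move=> ->; rewrite derive_coord //; exact: smooth_derivable sY Wy.
have [_] := H (index_enum _).
have -> : (fun z => \sum_i Y z 0 i *: (delta_mx 0 i : 'rV[R]_m)) = Y.
  by apply/funext => z; rewrite -row_sum_delta.
move=> ->; rewrite big_split /= -row_sum_delta; congr (_ + _).
rewrite [in RHS](row_sum_delta (Y y)) christoffel_sumr //.
by apply: eq_bigr => i _; rewrite christoffelZr.
Qed.

Lemma curvature_atE a b c y : W y ->
  curvature_at D y a b c =
    ('D_a (Gam b c) y + Gam a (Gam b c y) y) -
    ('D_b (Gam a c) y + Gam b (Gam a c y) y).
Proof.
move=> Wy; rewrite /curvature_at /curvature.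
have -> : lie_bracket (cst a) (cst b) = cst 0.
  by apply/funext => z; rewrite /lie_bracket !derive_cst subrr.
rewrite [D (cst 0) _ _]christoffel0l // subr0.
have E d e f : D (cst d) (D (cst e) (cst f)) y =
    'D_d (Gam e f) y + Gam d (Gam e f y) y.
  exact: (connection_cstE d (christoffel_smooth e f) Wy).
by rewrite !E.
Qed.

(** The matrix of Gamma^k, which reduces the product rule for
    Gamma(X, Y) to the one for bilinear forms. *)
Definition christoffel_form (k : 'I_m) y : 'M[R]_m :=
  \matrix_(i, j) Gam (delta_mx 0 i) (delta_mx 0 j) y 0 k.

Lemma christoffel_formE (k : 'I_m) a b y : W y ->
  Gam a b y 0 k = ip (christoffel_form k y) a b.
Proof.
move=> Wy; rewrite [in LHS](row_sum_delta a) christoffel_suml // summxE ipEsum.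
apply: eq_bigr => i _; rewrite christoffelZl //.
rewrite [in LHS](row_sum_delta b) christoffel_sumr // mxE summxE big_distrr /=.
by apply: eq_bigr => j _; rewrite christoffelZr // !mxE mulrA.
Qed.

Let christoffel_dform (k : 'I_m) (w y : 'rV[R]_m) : 'M[R]_m :=
  \matrix_(i, j) ('D_w (Gam (delta_mx 0 i) (delta_mx 0 j)) y) 0 k.

Let is_derive_christoffel_form (V : normedModType R) (F : V -> 'rV[R]_m)
    (x v : V) dF (k : 'I_m) : W (F x) -> is_derive x v F dF ->
  is_derive x v (fun z => christoffel_form k (F z)) (christoffel_dform k dF (F x)).
Proof.
move=> WF hF; apply/is_derive_mxP => i j.
have /is_derive_mxP/(_ 0 k) h :=
  is_derive_smooth_comp oW (christoffel_smooth (delta_mx 0 i) (delta_mx 0 j)) WF hF.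
have -> : (fun z => christoffel_form k (F z) i j : R^o) =
    (fun z => (Gam (delta_mx 0 i) (delta_mx 0 j) \o F) z 0 k : R^o).
  by apply/funext => z; rewrite mxE.
by rewrite mxE; exact: h.
Qed.

Let christoffel_dformE (k : 'I_m) w a b y : W y ->
  ip (christoffel_dform k w y) a b = ('D_w (Gam a b) y) 0 k.
Proof.
move=> Wy.
have h1 := is_derive_ip (is_derive_christoffel_form k Wy (is_derive_id y w))
  (is_derive_cst a y w) (is_derive_cst b y w).
rewrite ip0l ip0r !addr0 in h1.
rewrite -derive_coord; last exact: smooth_derivable (christoffel_smooth a b) Wy.
have [_ <-] := h1.
apply: near_eq_derive; apply: filterS (open_near oW Wy) => z Wz.
by rewrite christoffel_formE.
Qed.

(** The base point F z moves together with the arguments X z and Y z. *)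
Lemma is_derive_christoffel (V : normedModType R) (F X Y : V -> 'rV[R]_m)
    (x v : V) dF dX dY :
  (\forall z \near x, W (F z)) ->
  is_derive x v F dF -> is_derive x v X dX -> is_derive x v Y dY ->
  is_derive x v (fun z => Gam (X z) (Y z) (F z))
    ('D_dF (Gam (X x) (Y x)) (F x) + Gam dX (Y x) (F x) + Gam (X x) dY (F x)).
Proof.
move=> nW hF hX hY; have WF := nbhs_singleton nW.
apply/is_derive_mxP => i k; rewrite {i}(ord1 i).
have h := is_derive_ip (is_derive_christoffel_form k WF hF) hX hY.
rewrite christoffel_dformE // -!christoffel_formE // in h.
rewrite !mxE; apply: near_eq_is_derive h.
by apply: filterS nW => z Wz; rewrite christoffel_formE.
Qed.

End Christoffel.

(** * The Gauss equation *)

(** The cancellations behind the Gauss equation, for an arbitrary Gm,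
    linear in its second argument and symmetric on (pv, pw):
    T stands for third derivatives, H for second derivatives, D and d for the
    derivatives of the Christoffel symbols and of phi.  What survives is the
    coordinate expression of the curvature, and that of s. *)
Lemma antisymmetrization {R : realType} {m : nat}
    (Gm : 'rV[R]_m -> 'rV[R]_m -> 'rV[R]_m) (ph : 'cV[R]_m)
    (pv pw pz Hvw Hwv Hvz Hwz Tvw Twv Dv Dw : 'rV[R]_m) (dv dw : R) :
  (forall a b c, Gm a (b + c) = Gm a b + Gm a c) ->
  (forall a k b, Gm a (k *: b) = k *: Gm a b) ->
  Gm pv pw = Gm pw pv -> Tvw = Twv -> Hvw = Hwv ->
  (Tvw + (Dv + Gm Hvw pz + Gm pw Hvz)
   + ((dv + ev ph Hvz) *: pw + ev ph pz *: Hvw)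
   + Gm pv (Hwz + Gm pw pz + ev ph pz *: pw)
   + ev ph (Hwz + Gm pw pz + ev ph pz *: pw) *: pv) -
  (Twv + (Dw + Gm Hwv pz + Gm pv Hwz)
   + ((dw + ev ph Hwz) *: pv + ev ph pz *: Hwv)
   + Gm pw (Hvz + Gm pv pz + ev ph pz *: pv)
   + ev ph (Hvz + Gm pv pz + ev ph pz *: pv) *: pw) =
  (Dv + Gm pv (Gm pw pz) - (Dw + Gm pw (Gm pv pz)))
  + (dv - ev ph (Gm pv pz) - ev ph pv * ev ph pz) *: pw
  - (dw - ev ph (Gm pw pz) - ev ph pw * ev ph pz) *: pv.
Proof.
move=> GmD GmZ Gs -> ->; rewrite !(GmD, GmZ) !(evD, evZ) Gs.
by apply/rowP => i; rewrite !mxE; ring.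
Qed.

Section GaussEquation.
Context {R : realType} {n m : nat}.
Variables (U : set 'rV[R]_n) (F : 'rV[R]_n -> 'rV[R]_m).
Variables (W : set 'rV[R]_m) (G : 'rV[R]_m -> 'M[R]_m).
Variables (phi : 'rV[R]_m -> 'cV[R]_m).
Variables (D : vfield R m -> vfield R m -> vfield R m).
Variables (nabla : vfield R n -> vfield R n -> vfield R n).
Variables (sigma : vfield R n -> vfield R n -> 'rV[R]_n -> 'rV[R]_m).
Hypotheses (oU : open U) (oW : open W) (sF : smooth_on U F).
Hypothesis UW : forall x, U x -> W (F x).
Hypotheses (sG : smooth_on W G) (symG : forall y, W y -> (G y)^T = G y).
Hypotheses (sphi : smooth_on W phi) (lcD : levi_civita W G D).
Hypothesis gauss : gauss_decomposition U F G (semi_symmetric phi D) nabla sigma.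
Implicit Types (x v w z t : 'rV[R]_n).

Local Notation Gam := (christoffel D).
Local Notation II v w := (sigma (cst v) (cst w)).
Local Notation Hess v w := ('D_v ('D_w F)).

Let aD : affine_connection W D. Proof. by case: lcD. Qed.

Lemma pushD x v w : U x -> push F x (v + w) = push F x v + push F x w.
Proof. exact: smooth_deriveDv oU sF. Qed.

Lemma pushZ x (k : R) v : U x -> push F x (k *: v) = k *: push F x v.
Proof. exact: smooth_deriveZv oU sF. Qed.

Lemma pushB x v w : U x -> push F x (v - w) = push F x v - push F x w.
Proof. by move=> Ux; rewrite -scaleN1r pushD // pushZ // scaleN1r. Qed.

(** Near x, dF(Y) is the combination of the partial derivatives of F with the
    coordinates of Y as coefficients. *)
Lemma derivable_push Y x v : smooth_on U Y -> U x ->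
  derivable (fun q => push F q (Y q)) x v.
Proof.
move=> sY Ux.
have h : derivable (\sum_(a < n) (fun q => Y q 0 a *: 'D_(delta_mx 0 a) F q)) x v.
  apply: derivable_sum => a.
  have h1 : is_derive x v (fun q => Y q 0 a : R^o) ('D_v (fun q => Y q 0 a : R^o) x).
    exact/derivableP/(smooth_derivable (smooth_coord 0 a oU sY) Ux).
  have h2 := derivableP (smooth_derivable (v := v) (smooth_derive (delta_mx 0 a) sF) Ux).
  by have [] := is_derive_scale h1 h2.
apply: near_eq_derivable h; apply: filterS (open_near oU Ux) => q Uq.
by rewrite fct_sumE /push -(smooth_derive_sum (Y q) oU sF Uq).
Qed.

(** The semi-symmetric derivative along F of the tangent field dF(z), in the
    direction w: second derivative of F, Christoffel term, and the term
    phi(dF(z)) dF(w). *)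
Definition ambient_derivative w z x : 'rV[R]_m :=
  Hess w z x + Gam (push F x w) (push F x z) (F x)
  + ev (phi (F x)) (push F x z) *: push F x w.

Lemma gauss_formula w z x : U x ->
  ambient_derivative w z x = push F x (nabla (cst w) (cst z) x) + II w z x.
Proof.
move=> Ux; have [_ /(_ x Ux)[<- _]] := gauss (smooth_cst w) (smooth_cst z).
by rewrite /ambient_derivative -addrA.
Qed.

Lemma normal_II w z x : U x -> normal_vector F G x (II w z x).
Proof. by move=> Ux; have [_ /(_ x Ux)[]] := gauss (smooth_cst w) (smooth_cst z). Qed.

Lemma derive_metric a b c y : W y ->
  ip ('D_a G y) b c = ip (G y) (Gam a b y) c + ip (G y) b (Gam a c y).
Proof.
move=> Wy; have [_ _ mD] := lcD.
rewrite -(mD (cst a) (cst b) (cst c) (smooth_cst _) (smooth_cst _) (smooth_cst _) y Wy).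
have h := is_derive_ip (derivableP (smooth_derivable (v := a) sG Wy))
  (is_derive_cst b y a) (is_derive_cst c y a).
by rewrite ip0l ip0r !addr0 in h; have [_ ->] := h.
Qed.

Lemma christoffel_sym a b y : W y -> Gam a b y = Gam b a y.
Proof.
move=> Wy; have [_ tD _] := lcD.
apply/eqP; rewrite -subr_eq0; apply/eqP.
rewrite [LHS](tD (cst a) (cst b) (smooth_cst _) (smooth_cst _) y Wy).
by rewrite /lie_bracket !derive_cst subrr.
Qed.

Lemma Hess_sym v w x : U x -> Hess v w x = Hess w v x.
Proof. exact: smooth_derive_comm oU sF. Qed.

Variable u : 'rV[R]_n.
Hypothesis Uu : U u.

Local Notation y := (F u).
Local Notation dF := (push F u).
Local Notation dot := (ip (G (F u))).
Local Notation ph := (ev (phi (F u))).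

Let Wy : W y. Proof. exact: UW. Qed.

Let is_derive_F v : is_derive u v F (dF v).
Proof. exact/derivableP/(smooth_derivable sF Uu). Qed.

Let is_derive_dF v w : is_derive u v ('D_w F) (Hess v w u).
Proof. exact/derivableP/(smooth_derivable (smooth_derive w sF) Uu). Qed.

Let near_W : \forall x \near u, W (F x).
Proof. by apply: filterS (open_near oU Uu); exact: UW. Qed.

(** The derivative along v of [ambient_derivative w z] at u, by the product
    rule. *)
Definition ambient_derivative2 v w z : 'rV[R]_m :=
  'D_v (Hess w z) u
  + ('D_(dF v) (Gam (dF w) (dF z)) y + Gam (Hess v w u) (dF z) y
     + Gam (dF w) (Hess v z u) y)
  + ((ev ('D_(dF v) phi y) (dF z) + ph (Hess v z u)) *: dF w
     + ph (dF z) *: Hess v w u).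

Lemma is_derive_ambient_derivative v w z :
  is_derive u v (ambient_derivative w z) (ambient_derivative2 v w z).
Proof.
have h1 := derivableP (smooth_derivable (v := v)
  (smooth_derive w (smooth_derive z sF)) Uu).
have h2 := is_derive_christoffel oW aD near_W (is_derive_F v)
  (is_derive_dF v w) (is_derive_dF v z).
have h3 := is_derive_ev (is_derive_smooth_comp oW sphi Wy (is_derive_F v))
  (is_derive_dF v z).
have h4 := is_derive_scale h3 (is_derive_dF v w).
exact: is_deriveD (is_deriveD h1 h2) h4.
Qed.

Lemma is_derive_II v w z : is_derive u v (II w z)
  (ambient_derivative2 v w z - 'D_v (fun q => push F q (nabla (cst w) (cst z) q)) u).
Proof.
have [sY _] := gauss (smooth_cst w) (smooth_cst z).
have h := is_deriveB (is_derive_ambient_derivative v w z)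
  (derivableP (derivable_push (v := v) sY Uu)).
apply: near_eq_is_derive h; apply: filterS (open_near oU Uu) => q Uq.
by rewrite -[LHS]/(ambient_derivative w z q - _) gauss_formula // addrC addKr.
Qed.

(** Differentiate <dF(t), II(w, z)> = 0 along v: metric compatibility moves the
    derivative to dF(t), whose normal part is II(v, t). *)
Lemma weingarten v w z t :
  dot (dF t) ('D_v (II w z) u + Gam (dF v) (II w z u) y) =
  - dot (II v t u) (II w z u).
Proof.
have [dII _] := is_derive_II v w z.
have h := is_derive_ip (is_derive_smooth_comp oW sG Wy (is_derive_F v))
  (is_derive_dF v t) (derivableP dII).
have h0 : is_derive u v (fun q => ip (G (F q)) ('D_t F q) (II w z q) : R^o) 0.
  apply: near_eq_is_derive (is_derive_cst (0 : R^o) u v).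
  apply: filterS (open_near oU Uu) => q Uq.
  by rewrite /cst (normal_II w z Uq t).
have [_ E] := h; have [_ E0] := h0.
rewrite E0 /= derive_metric // in E.
have Gs := gauss_formula v t Uu.
rewrite /ambient_derivative in Gs.
have Et : dot (Hess v t u + Gam (dF v) (dF t) y) (II w z u) =
    dot (II v t u) (II w z u).
  have -> : Hess v t u + Gam (dF v) (dF t) y =
      dF (nabla (cst v) (cst t) u) + II v t u - ph (dF t) *: dF v.
    by rewrite -Gs addrK.
  rewrite !ipDl ipNl ipZl !(normal_II w z Uu _).
  by rewrite mulr0 subr0 add0r.
rewrite -Et ipDl ipDr.
move: E; rewrite /push.
set a1 := ip _ _ _; set a2 := ip _ _ _; set a3 := ip _ _ _; set a4 := ip _ _ _.
move=> E; lra.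
Qed.

(** By the Gauss formula dF(nabla_w z) is the ambient derivative minus II(w, z);
    the tangential part of the derivative of II(w, z) is given by
    [weingarten]. *)
Lemma tangential_second_derivative v w z t :
  dot (dF t) (dF (nabla (cst v) (nabla (cst w) (cst z)) u)) =
  dot (dF t) (ambient_derivative2 v w z
              + Gam (dF v) (ambient_derivative w z u) y
              + ph (ambient_derivative w z u) *: dF v)
  + dot (II v t u) (II w z u) - ph (II w z u) * dot (dF t) (dF v).
Proof.
have [sY _] := gauss (smooth_cst w) (smooth_cst z).
have [_ /(_ u Uu)[E nrm]] := gauss (smooth_cst v) sY.
have [_ dII] := is_derive_II v w z.
have := weingarten v w z t; rewrite dII.
set dT := 'D_v _ u; set T := push F u (nabla (cst w) (cst z) u).
have E' : dT + (Gam (dF v) T y + ph T *: dF v) =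
    dF (nabla (cst v) (nabla (cst w) (cst z)) u)
    + sigma (cst v) (nabla (cst w) (cst z)) u by exact: E.
have -> : dF (nabla (cst v) (nabla (cst w) (cst z)) u) =
    dT + (Gam (dF v) T y + ph T *: dF v)
    - sigma (cst v) (nabla (cst w) (cst z)) u by rewrite E' addrK.
rewrite (gauss_formula w z Uu) -/T (christoffelDr aD) // evD.
have : dot (dF t) (sigma (cst v) (nabla (cst w) (cst z)) u) = 0 := nrm t.
generalize (ambient_derivative2 v w z) (sigma (cst v) (nabla (cst w) (cst z)) u) dT.
generalize (Gam (dF v) T y) (Gam (dF v) (II w z u) y) (dot (II v t u) (II w z u)).
generalize (ph T) (ph (II w z u)) (dF t) (dF v).
move=> kT kS pt pv GT GS r A2 s' dT' s0.
rewrite !(ipDr, ipNr, ipZr) s0 => H; lra.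
Qed.

(** Third derivatives of F are symmetric in v and w, and so are its second
    derivatives and the Christoffel symbols. *)
Lemma ambient_derivative_antisym v w z :
  (ambient_derivative2 v w z + Gam (dF v) (ambient_derivative w z u) y
   + ph (ambient_derivative w z u) *: dF v) -
  (ambient_derivative2 w v z + Gam (dF w) (ambient_derivative v z u) y
   + ph (ambient_derivative v z u) *: dF w) =
  curvature_at D y (dF v) (dF w) (dF z) +
  s_tensor D phi y (dF v) (dF z) *: dF w - s_tensor D phi y (dF w) (dF z) *: dF v.
Proof.
have E a b : s_tensor D phi y a b =
    ev ('D_a phi y) b - ph (Gam a b y) - ph a * ph b.
  rewrite /s_tensor /cov_form; congr (_ - _ - _).
  have h := is_derive_ev (derivableP (smooth_derivable (v := a) sphi Wy))
    (is_derive_cst b y a).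
  have [_ hE] := h.
  by rewrite [LHS]hE /cst -[in RHS](addr0 (ev _ b)); congr (_ + _); rewrite /ev mul0mx mxE.
rewrite (E (dF v) (dF z)) (E (dF w) (dF z)).
rewrite (curvature_atE oW aD (dF v) (dF w) (dF z) Wy).
have Gad a b c : Gam a (b + c) y = Gam a b y + Gam a c y by exact: (christoffelDr aD).
have Gsc a k b : Gam a (k *: b) y = k *: Gam a b y by exact: (christoffelZr aD).
have sT := smooth_derive_comm w v oU (smooth_derive z sF) Uu.
exact: (@antisymmetrization _ _ (fun a b => Gam a b y) (phi y) (dF v) (dF w) (dF z)
  (Hess v w u) (Hess w v u) (Hess v z u) (Hess w z u) _ _
  ('D_(dF v) (Gam (dF w) (dF z)) y) ('D_(dF w) (Gam (dF v) (dF z)) y)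
  (ev ('D_(dF v) phi y) (dF z)) (ev ('D_(dF w) phi y) (dF z))
  Gad Gsc (christoffel_sym (dF v) (dF w) Wy) sT (Hess_sym v w Uu)).
Qed.

Lemma gauss_equation v w z t :
  induced_metric F G u (curvature_at nabla u v w z) t =
  ip (G y) (curvature_at D y (dF v) (dF w) (dF z)) (dF t)
  + (s_tensor D phi y (dF v) (dF z) + ph (II v z u)) * induced_metric F G u w t
  - (s_tensor D phi y (dF w) (dF z) + ph (II w z u)) * induced_metric F G u v t
  + dot (II v t u) (II w z u) - dot (II w t u) (II v z u).
Proof.
have Wy' := Wy; have sGy := symG Wy'.
have lie0 : dot (dF t) (dF (nabla (lie_bracket (cst v) (cst w)) (cst z) u)) = 0.
  have -> : lie_bracket (cst v) (cst w) = cst 0.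
    by apply/funext => x; rewrite /lie_bracket !derive_cst subrr.
  have := gauss_formula 0 z Uu.
  rewrite /ambient_derivative derive0 /push derive0 -/(push F u _).
  rewrite (christoffel0l aD) // scaler0 !addr0 => /esym/eqP.
  rewrite addr_eq0 => /eqP ->.
  by rewrite ipNr (normal_II 0 z Uu t) oppr0.
have T1 := tangential_second_derivative v w z t.
have T2 := tangential_second_derivative w v z t.
have H := congr1 (fun X => dot (dF t) X) (ambient_derivative_antisym v w z).
have P a b c : dot (dF t) (dF (a - b - c)) =
    dot (dF t) (dF a) - dot (dF t) (dF b) - dot (dF t) (dF c).
  rewrite (pushB (a - b) c Uu) (pushB a b Uu).
  by generalize (dF t) (dF a) (dF b) (dF c) => * ; rewrite !(ipDr, ipNr).
have E0 : induced_metric F G u (curvature_at nabla u v w z) t =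
    dot (dF t) (dF (nabla (cst v) (nabla (cst w) (cst z)) u)) -
    dot (dF t) (dF (nabla (cst w) (nabla (cst v) (cst z)) u)).
  apply: (etrans (ip_sym (dF _) (dF t) sGy)).
  apply: (etrans (P (nabla (cst v) (nabla (cst w) (cst z)) u)
    (nabla (cst w) (nabla (cst v) (cst z)) u)
    (nabla (lie_bracket (cst v) (cst w)) (cst z) u))).
  exact: (etrans (congr1 (fun r => _ - _ - r) lie0) (subr0 _)).
have Ew : induced_metric F G u w t = dot (dF t) (dF w) by exact: ip_sym.
have Ev : induced_metric F G u v t = dot (dF t) (dF v) by exact: ip_sym.
have Er := ip_sym (curvature_at D y (dF v) (dF w) (dF z)) (dF t) sGy.
(* Once the curvatures and the inner products are generalized, a linear
   identity between real numbers remains. *)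
move: E0 Ew Ev Er T1 T2 H.
generalize (induced_metric F G u (curvature_at nabla u v w z) t)
  (induced_metric F G u w t) (induced_metric F G u v t)
  (ip (G y) (curvature_at D y (dF v) (dF w) (dF z)) (dF t))
  (dot (dF t) (dF (nabla (cst v) (nabla (cst w) (cst z)) u)))
  (dot (dF t) (dF (nabla (cst w) (nabla (cst v) (cst z)) u))).
move=> Rtot gw gv Rl d1 d2.
generalize (ambient_derivative2 v w z + Gam (dF v) (ambient_derivative w z u) y
   + ph (ambient_derivative w z u) *: dF v).
generalize (ambient_derivative2 w v z + Gam (dF w) (ambient_derivative v z u) y
   + ph (ambient_derivative v z u) *: dF w).
generalize (curvature_at D y (dF v) (dF w) (dF z)).
generalize (s_tensor D phi y (dF v) (dF z)) (s_tensor D phi y (dF w) (dF z)).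
generalize (dot (II v t u) (II w z u)) (dot (II w t u) (II v z u)).
generalize (ph (II v z u)) (ph (II w z u)) (dF t) (dF v) (dF w).
move=> kv kw pt pv pw i1 i2 sv sw Rm X2 X1.
move=> -> -> -> -> -> ->; rewrite !(ipDr, ipNr, ipZr) => H; lra.
Qed.

Hypothesis posG : forall a, a != 0 -> 0 < dot a a.

(** II(v, w) - II(w, v) is both normal and tangent: the ambient derivatives of
    dF(w) along v and of dF(v) along w differ by the tangent vector
    phi(dF(w)) dF(v) - phi(dF(v)) dF(w). *)
Lemma second_fundamental_form_sym v w : II v w u = II w v u.
Proof.
have E v1 w1 : II v1 w1 u = ambient_derivative v1 w1 u
    - dF (nabla (cst v1) (cst w1) u) by rewrite gauss_formula // addrC addKr.
have tang : II v w u - II w v u = dF (ph (dF w) *: v - ph (dF v) *: w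
    - nabla (cst v) (cst w) u + nabla (cst w) (cst v) u).
  rewrite (pushD _ _ Uu) (pushB _ _ Uu) (pushB _ _ Uu) (pushZ _ _ Uu) (pushZ _ _ Uu).
  rewrite (E v w) (E w v) /ambient_derivative.
  rewrite (Hess_sym v w Uu) (christoffel_sym (dF v) (dF w) Wy).
  generalize (Hess w v u) (Gam (dF w) (dF v) y) (ph (dF w)) (ph (dF v)) (dF v) (dF w).
  generalize (dF (nabla (cst v) (cst w) u)) (dF (nabla (cst w) (cst v) u)) => *.
  by apply/rowP => i; rewrite !mxE; ring.
apply/eqP; rewrite -subr_eq0; apply/negPn/negP => /posG.
by rewrite {1}tang ipDr ipNr (normal_II v w Uu _) (normal_II w v Uu _) subr0 ltxx.
Qed.

End GaussEquation.

(** * Inner products and orthonormal frames *)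

Section InnerProducts.
Context {R : realType} {m : nat}.
Variable G : 'M[R]_m.
Local Notation dot := (ip G).

Lemma ip_row k (B : 'M[R]_(k, m)) i j :
  (B *m G *m B^T) i j = dot (row i B) (row j B).
Proof.
rewrite /ip tr_row -row_mul !mxE.
by apply: eq_bigr => a _; rewrite !mxE.
Qed.

Lemma orthonormal_row_free a b :
  dot a a = 1 -> dot b b = 1 -> dot a b = 0 -> dot b a = 0 ->
  row_free (col_mx a b).
Proof.
move=> aa bb ab ba; apply: inj_row_free => z.
rewrite -(hsubmxK z) mul_row_col => E.
have Z (x : 'M[R]_1) (v : 'rV[R]_m) : x *m v = x 0 0 *: v.
  by rewrite [x in LHS]mx11_scalar mul_scalar_mx.
rewrite !Z in E.
have l0 : lsubmx z 0 0 = 0.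
  by have := congr1 (dot^~ a) E; rewrite ipDl !ipZl aa ba mulr1 mulr0 addr0 ip0l.
have r0 : rsubmx z 0 0 = 0.
  by have := congr1 (dot^~ b) E; rewrite ipDl !ipZl bb ab mulr1 mulr0 add0r ip0l.
by rewrite [lsubmx z]mx11_scalar [rsubmx z]mx11_scalar l0 r0 !raddf0 row_mx0.
Qed.

Hypothesis symG : G^T = G.

Lemma ip_subZ_sq (k : R) a b :
  dot (a - k *: b) (a - k *: b) = dot a a - (k *+ 2) * dot a b + k ^+ 2 * dot b b.
Proof.
by rewrite !(ipDl, ipDr, ipNl, ipNr, ipZl, ipZr) (ip_sym b a symG); ring.
Qed.

(** With n H the trace of II, the sum over j <> i1 of <II i1 i1, II j j> is
    <II i1 i1, n H - II i1 i1>; completing the square in II i1 i1 gives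
    n^2/4 |H|^2 - |II i1 i1 - (n/2) H|^2. *)
Lemma ricci_completed_square n (n0 : (0 < n)%N) (i1 : 'I_n) (c : R)
    (K s : 'I_n -> R) (II : 'I_n -> 'I_n -> 'rV[R]_m) (q : 'rV[R]_m) :
  (forall j, j != i1 ->
    K j = c - (s j + dot q (II j j)) + dot (II i1 i1) (II j j)
          - dot (II i1 j) (II i1 j)) ->
  let H := n%:R^-1 *: \sum_(j < n) II j j in
  let d := II i1 i1 - (n%:R / 2) *: H in
  (n%:R - 1) * c - \sum_(j < n) s j + s i1 - n%:R * dot q H
    + dot q (II i1 i1) + n%:R ^+ 2 / 4 * dot H H
  = \sum_(j < n | j != i1) K j
    + (dot d d + \sum_(j < n | j != i1) dot (II i1 j) (II i1 j)).
Proof.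
move=> hK H d.
have nR0 : n%:R != 0 :> R by rewrite pnatr_eq0 -lt0n.
have HE : \sum_(j < n) II j j = n%:R *: H by rewrite scalerA divff // scale1r.
have D1 (f : 'I_n -> R) : \sum_(j < n | j != i1) f j = \sum_j f j - f i1.
  by rewrite [in RHS](bigD1 i1) //= addrAC subrr add0r.
rewrite (eq_bigr _ hK) !big_split /= !sumrN !D1 big_split /= !sumr_const.
rewrite -!ip_sumr HE /d ip_subZ_sq !ipZr !card_ord -mulr_natl.
by field.
Qed.

End InnerProducts.

Lemma sectional_curvature_orthonormal {R : realType} {m : nat}
    (G : 'rV[R]_m -> 'M[R]_m) D (y a b : 'rV[R]_m) :
  ip (G y) a a = 1 -> ip (G y) b b = 1 -> ip (G y) a b = 0 ->
  sectional_curvature G D y a b = ip (G y) (curvature_at D y a b b) a.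
Proof.
by rewrite /sectional_curvature => -> -> ->; rewrite expr0n subr0 mulr1 divr1.
Qed.

(** The n tangent and p normal vectors of the frames are the rows of a square
    matrix B with B G B^T = 1, so B G is invertible and kills xi only if xi = 0. *)
Lemma normal_vector_eq0 {R : realType} {n p : nat} (F : 'rV[R]_n -> 'rV[R]_(n + p))
    (G : 'rV[R]_(n + p) -> 'M[R]_(n + p)) (u : 'rV[R]_n)
    (e : 'I_n -> 'rV[R]_n) (nu : 'I_p -> 'rV[R]_(n + p)) xi :
  (G (F u))^T = G (F u) -> tangent_frame F G u e -> normal_frame F G u nu ->
  normal_vector F G u xi -> (forall a, ip (G (F u)) xi (nu a) = 0) -> xi = 0.
Proof.
move=> sG fe [nn fnu] nxi xinu.
pose B := col_mx (\matrix_(i < n) push F u (e i)) (\matrix_(a < p) nu a).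
have Bl i : row (lshift p i) B = push F u (e i) by rewrite rowKu rowK.
have Br a : row (rshift n a) B = nu a by rewrite rowKd rowK.
have B1 : B *m G (F u) *m B^T = 1%:M.
  apply/matrixP => i j; rewrite ip_row mxE.
  case: (split_ordP i) => i' ->; case: (split_ordP j) => j' ->.
  - by rewrite !Bl eq_shift; exact: fe.
  - by rewrite Bl Br eq_shift; exact: nn.
  - by rewrite Bl Br eq_shift (ip_sym _ _ sG); exact: nn.
  - by rewrite !Br eq_shift; exact: fnu.
have [uB _] := mulmx1_unit B1.
have B0 : B *m G (F u) *m xi^T = 0.
  apply/colP => i.
  have -> : (B *m G (F u) *m xi^T) i 0 = ip (G (F u)) (row i B) xi.
    by rewrite /ip -!row_mul [RHS]mxE.
  rewrite mxE; case: (split_ordP i) => i' ->.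
    by rewrite Bl; exact: nxi.
  by rewrite Br (ip_sym _ _ sG); exact: xinu.
by apply: trmx_inj; rewrite -[LHS](mulKmx uB) B0 mulmx0 trmx0.
Qed.

(** A point of the domain has a neighbourhood in the image of the chart, where
    the inverse of the chart is continuous. *)
Lemma local_dom_open {R : realType} {n m : nat} (M : @manifold R n)
    (N : @manifold R m) (f : M -> N) i k : continuous f -> open (local_dom f i k).
Proof.
move=> cf; rewrite openE => _ [x [ix kx] <-].
have oO : open (chart_dom i `&` f @^-1` chart_dom k).
  apply: openI; first exact: chart_dom_open.
  by apply: open_comp; [move=> z _; exact: cf|exact: chart_dom_open].
have cu : (chart_map i @` chart_dom i) (chart_map i x) by exists x.
have n1 : \forall z \near chart_map i x, (chart_map i @` chart_dom i) z.
  exact: open_near (@chart_map_open _ _ M i) cu.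
have n2 : \forall z \near chart_map i x,
    (chart_dom i `&` f @^-1` chart_dom k) (chart_inv i z).
  have Oz : (chart_dom i `&` f @^-1` chart_dom k) (chart_inv i (chart_map i x)).
    by rewrite chart_mapK.
  exact: (chart_inv_continuous cu (open_near oO Oz)).
apply: filterS (filterI n1 n2) => z [[x' ix' <-]]; rewrite chart_mapK // => Ox'.
by exists x'.
Qed.

(** * The Ricci inequality *)

Theorem proposition4p3 (R : realType) (n p : nat) (hn : (2 <= n)%N) (c : R)
    (N : @manifold R (n + p)) (g : riemannian_metric N)
    (hc : constant_curvature g c) (phi : one_form N)
    (M : @manifold R n) (f : M -> N) (hf : immersion f)
    (x : M) (i : chart M) (k : chart N) (hi : chart_dom i x) (hk : chart_dom k (f x))
    (D0 : vfield R (n + p) -> vfield R (n + p) -> vfield R (n + p))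
    (hD0 : levi_civita (chart_codom k) (g k) D0)
    (nabla : vfield R n -> vfield R n -> vfield R n)
    (sigma : vfield R n -> vfield R n -> 'rV[R]_n -> 'rV[R]_(n + p))
    (hgauss : gauss_decomposition (local_dom f i k) (local_map f i k) (g k)
                (semi_symmetric (phi k) D0) nabla sigma) :
  let F := local_map f i k in
  let u := chart_map i x in
  let dF := push F u in
  let y := chart_map k (f x) in
  let dot := ip (g k y) in
  let s := s_tensor D0 (phi k) y in
  let sff v w := sigma (cst v) (cst w) u in
  let i1 : 'I_n := Ordinal (ltnW hn) in
  forall (P Pperp : 'rV[R]_(n + p)) (Ptop : 'rV[R]_n),
    (forall v, dot P v = ev (phi k y) v) ->
    P = dF Ptop + Pperp -> normal_vector F (g k) u Pperp ->
  forall X : 'rV[R]_n, induced_metric F (g k) u X X = 1 ->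
  forall e : 'I_n -> 'rV[R]_n, tangent_frame F (g k) u e -> e i1 = X ->
  let H := mean_curvature sff e in
  let lambda := \sum_(j < n) s (dF (e j)) (dF (e j)) in
  let Ric := Ricci F (g k) nabla u e i1 in
  let bound := (n%:R - 1) * c - lambda + s (dF X) (dF X)
               - n%:R * dot Pperp H + dot Pperp (sff X X)
               + n%:R ^+ 2 / 4 * dot H H in
  Ric <= bound /\
  forall nu : 'I_p -> 'rV[R]_(n + p), normal_frame F (g k) u nu ->
    (Ric = bound <->
     forall a : 'I_p,
       dot (sff (e i1) (e i1)) (nu a) =
         n%:R / 2 * (n%:R^-1 * \sum_(j < n) dot (sff (e j) (e j)) (nu a)) /\
       forall j : 'I_n, j != i1 -> dot (sff (e i1) (e j)) (nu a) = 0).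
Proof.
move=> F u dF y dot s sff i1 P Pperp Ptop hP hPE nP X _ e fe <- H lambda Ric bound.
have oU : open (local_dom f i k) by case: hf => cf _; exact: local_dom_open.
have oW : open (chart_codom k) by exact: chart_map_open.
have sF : smooth_on (local_dom f i k) F by case: hf => _ /(_ i k)[].
have UW z : local_dom f i k z -> chart_codom k (F z).
  move=> [x' [ix' kx'] <-]; exists (f x') => //.
  by rewrite /F /local_map /= chart_mapK.
have Uu : local_dom f i k u by exists x.
have yE : F u = y by rewrite /F /local_map /= chart_mapK.
have Wy : chart_codom k y by exists (f x).
have sG := @metric_smooth _ _ _ g k.
have symG z : chart_codom k z -> (g k z)^T = g k z by exact: (@Defs.metric_sym _ _ _ g k z).
have sphi := @form_smooth _ _ _ phi k.
have sGy : (g k y)^T = g k y by exact: symG.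
have posG a : a != 0 -> 0 < dot a a by exact: (@metric_pos _ _ _ g k y a Wy).
have normII v w t : dot (dF t) (sff v w) = 0.
  by have := normal_II hgauss v w Uu t; rewrite -/F yE.
have IIC v w : sff v w = sff w v.
  have posG' a : a != 0 -> 0 < ip (g k (F u)) a a by rewrite yE; exact: posG.
  exact: (second_fundamental_form_sym oU sF UW hD0 hgauss Uu posG' v w).
have dot_e j l : dot (dF (e j)) (dF (e l)) = (j == l)%:R.
  by have := fe j l; rewrite /induced_metric -/F yE.
have evII v w : ev (phi k y) (sff v w) = dot Pperp (sff v w).
  by rewrite -hP hPE /dot ipDl [X in X + _]normII add0r.
have dotPP a : 0 <= dot a a.
  by have [->|/posG/ltW//] := eqVneq a 0; rewrite /dot ip0l.
have dot_eq0 a : dot a a = 0 -> a = 0.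
  by move=> a0; apply/eqP/negPn/negP => /posG; rewrite a0 ltxx.
(* The plane of e_1 and e_j has an orthonormal basis, so the ambient term of
   the Gauss equation is its sectional curvature. *)
have gaussK j : j != i1 ->
    induced_metric F (g k) u (curvature_at nabla u (e i1) (e j) (e j)) (e i1) =
    c - (s (dF (e j)) (dF (e j)) + dot Pperp (sff (e j) (e j)))
    + dot (sff (e i1) (e i1)) (sff (e j) (e j))
    - dot (sff (e i1) (e j)) (sff (e i1) (e j)).
  move=> ji.
  have := gauss_equation oU oW sF UW sG symG sphi hD0 hgauss Uu (e i1) (e j) (e j) (e i1).
  rewrite -/F yE (fe j i1) (fe i1 i1) (negPf ji) eqxx mulr0 addr0 mulr1 => ->.
  have i1j : (i1 == j) = false by rewrite eq_sym (negPf ji).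
  have rf : row_free (col_mx (dF (e i1)) (dF (e j))).
    by apply: (@orthonormal_row_free _ _ (g k y));
       rewrite [LHS]dot_e ?eqxx // ?i1j ?(negPf ji).
  have Rc := hc k D0 hD0 y Wy _ _ rf.
  rewrite sectional_curvature_orthonormal in Rc.
  - rewrite Rc [ev _ _](evII (e j) (e j)).
    by rewrite [sigma (cst (e j)) (cst (e i1)) _](IIC (e j) (e i1)).
  - by rewrite [LHS]dot_e eqxx.
  - by rewrite [LHS]dot_e eqxx.
  - by rewrite [LHS]dot_e i1j.
pose d := sff (e i1) (e i1) - (n%:R / 2) *: H.
pose S := \sum_(j < n | j != i1) dot (sff (e i1) (e j)) (sff (e i1) (e j)).
have boundE : bound = Ric + (dot d d + S).
  exact: (@ricci_completed_square _ _ _ sGy n (ltnW hn) i1 c _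
    (fun j => s (dF (e j)) (dF (e j))) (fun j l => sff (e j) (e l)) Pperp gaussK).
have S0 : 0 <= S by apply: sumr_ge0 => j _; exact: dotPP.
have dotHl a : dot H a = n%:R^-1 * \sum_(j < n) dot (sff (e j) (e j)) a.
  by rewrite /dot ipZl ip_suml.
split; first by rewrite boundE lerDl addr_ge0.
move=> nu fnu; split.
  move=> RE a.
  have /eqP : dot d d + S = 0 by apply: (addrI Ric); rewrite -boundE addr0.
  rewrite paddr_eq0 // => /andP[/eqP /dot_eq0 /eqP + /eqP ES].
  rewrite subr_eq0 => /eqP Ed; split; first by rewrite Ed -dotHl; exact: ipZl.
  move=> j ji.
  have /(_ j ji)/dot_eq0 -> := psumr_eq0P (fun j _ => dotPP _) ES.
  exact: ip0l.
move=> Hnu.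
have nH : forall t, dot (dF t) H = 0.
  move=> t; rewrite /dot ipZr ip_sumr big1 ?mulr0 // => j _; exact: normII.
have normal_eq0 xi : (forall t, dot (dF t) xi = 0) ->
    (forall a, dot xi (nu a) = 0) -> xi = 0.
  rewrite /dot -yE => nxi xinu.
  by apply: (normal_vector_eq0 _ fe fnu nxi xinu); rewrite yE.
have d0 : d = 0.
  apply: normal_eq0 => [t|a].
    rewrite /dot ipDr ipNr ipZr [X in X - _]normII [X in _ - _ * X]nH.
    by rewrite mulr0 subr0.
  have [Ea _] := Hnu a.
  by rewrite /dot ipDl ipNl ipZl [X in X - _]Ea [X in _ - _ * X]dotHl subrr.
have z0 j : j != i1 -> sff (e i1) (e j) = 0.
  move=> ji; apply: normal_eq0 => [t|a]; first exact: normII.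
  by have [_ /(_ j ji)] := Hnu a.
rewrite boundE d0 /S big1 ?addr0 ?[dot 0 0]ip0l ?addr0 // => j ji.
by rewrite z0 // [LHS]ip0l.
Qed.
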